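(* If $G$ is a $2$-connected outerplanar graph with $\Delta(G)=3$, then $\chi_{vi,2}(G)\leq 6$. Moreover, the bound is tight: there exists a $2$-connected outerplanar graph $G$ with $\Delta(G)=3$ and $\chi_{vi,2}(G)=6$.
   Context: All graphs are finite, simple and undirected. An incidence of $G$ is a pair $(v,e)$ with $v\in V(G)$, $e\in E(G)$, $v\in e$; $I(G)$ is the set of incidences. Let $G^{1/3}$ be obtained from $G$ by replacing each edge $e=\{u,v\}$ by the path $u,(u,e),(v,e),v$. A $vi$-simultaneous proper $k$-coloring of $G$ is a map $c:V(G)\cup I(G)\to\{1,\dots,k\}$ such that any two distinct elements at distance at most $3$ in $G^{1/3}$ receive distinct colors. For a vertex $v$, $I_2(v)=\{(u,\{u,v\}) : u\in N_G(v)\}$. Such a coloring is a $(k,s)$-coloring if for every vertex $v$ at most $s$ distinct colors appear on $I_2(v)$; $\chi_{vi,s}(G)$ is the least such $k$. A graph is outerplanar if it has a planar drawing with all vertices on the outer face. *)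

(* Defs.v *)
From HB Require Import structures.
From mathcomp Require Import all_boot all_order all_algebra.
From mathcomp Require Import all_classical all_reals all_analysis.
Set Implicit Arguments.
Unset Strict Implicit.
Unset Printing Implicit Defensive.
Import Order.TTheory GRing.Theory Num.Theory.
Import numFieldNormedType.Exports.
Local Open Scope ring_scope.
Local Open Scope classical_set_scope.

Record sgraph := SGraph {
  vertex :> finType;
  adj : rel vertex;
  adj_sym : symmetric adj;
  adj_irrefl : irreflexive adj }.

Definition edges (G : sgraph) : {set {set G}} :=
  [set [set x; y]%SET | x in G, y in G & adj x y]%SET.

Definition neighbours (G : sgraph) (v : G) : {set G} := [set u | adj v u]%SET.

Definition max_degree (G : sgraph) : nat := \max_(v : G) #|neighbours v|.

Definition connected_on (G : sgraph) (S : {set G}) : Prop :=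
  {in S &, forall x y,
    connect [rel a b | [&& a \in S, b \in S & adj a b]] x y}.

Definition k_connected (k : nat) (G : sgraph) : Prop :=
  (k < #|G|)%N /\
  forall X : {set G}, (#|X| < k)%N -> connected_on (~: X)%SET.

Definition dist_le (G : sgraph) (n : nat) (x y : G) : Prop :=
  exists p : seq G, [/\ path (@adj G) x p, last x p = y & (size p <= n)%N].

(* Plane drawings.  The vertex v is drawn at p v; the edge e is drawn as the
   simple arc t |-> a e t, 0 <= t <= 1.  The values of a e for e not an edge,
   or of a e t for t outside [0, 1], play no role. *)

Definition arc_image (R : realType) (g : R -> R * R) : set (R * R) :=
  g @` `[0, 1].

Definition arc_interior (R : realType) (g : R -> R * R) : set (R * R) :=
  g @` `]0, 1[.

Record plane_drawing (R : realType) (G : sgraph)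
    (p : G -> R * R) (a : {set G} -> R -> R * R) : Prop := PlaneDrawing {
  drawing_vertex_inj : injective p;
  drawing_arc_continuous : forall e, e \in edges G ->
    {within `[0, 1], continuous (a e)};
  drawing_arc_inj : forall e, e \in edges G -> {in `[0, 1]%R &, injective (a e)};
  drawing_arc_ends : forall e, e \in edges G ->
    [set a e 0; a e 1] = p @` [set` e];
  drawing_arc_vertex : forall e v, e \in edges G -> ~ arc_interior (a e) (p v);
  drawing_arc_arc : forall e f, e \in edges G -> f \in edges G -> e <> f ->
    arc_interior (a e) `&` arc_image (a f) = set0 }.

Definition drawing_set (R : realType) (G : sgraph)
    (p : G -> R * R) (a : {set G} -> R -> R * R) : set (R * R) :=
  range p `|` \bigcup_(e in [set` edges G]) arc_image (a e).

Definition face (R : realType) (D F : set (R * R)) : Prop :=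
  exists2 x, (~` D) x & F = connected_component (~` D) x.

Definition outer_face (R : realType) (D F : set (R * R)) : Prop :=
  face D F /\ ~ bounded_set F.

Definition boundary (T : topologicalType) (A : set T) : set T :=
  closure A `\` interior A.

Definition outerplanar (R : realType) (G : sgraph) : Prop :=
  exists (p : G -> R * R) (a : {set G} -> R -> R * R),
    plane_drawing p a /\
    exists2 F, outer_face (drawing_set p a) F & forall v, boundary F (p v).

Definition incidence (G : sgraph) : finType :=
  {i : G * {set G} | (i.2 \in edges G) && (i.1 \in i.2)}.

Definition subdiv3_adj (G : sgraph) (x y : G + incidence G) : bool :=
  match x, y with
  | inl _, inl _ => false
  | inl v, inr i | inr i, inl v => (val i).1 == v
  | inr i, inr j => ((val i).2 == (val j).2) && ((val i).1 != (val j).1)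
  end.

Lemma subdiv3_adj_sym (G : sgraph) : symmetric (@subdiv3_adj G).
Proof. by case=> [u|i] [v|j] //=; rewrite eq_sym (eq_sym (val i).1). Qed.

Lemma subdiv3_adj_irrefl (G : sgraph) : irreflexive (@subdiv3_adj G).
Proof. by case=> [u|i] //=; rewrite !eqxx. Qed.

Definition subdiv3 (G : sgraph) : sgraph :=
  SGraph (@subdiv3_adj_sym G) (@subdiv3_adj_irrefl G).

Definition vi_coloring (G : sgraph) (k : nat) (c : G + incidence G -> 'I_k) :
    Prop :=
  forall x y : subdiv3 G, x <> y -> dist_le 3 x y -> c x <> c y.

Definition I2 (G : sgraph) (v : G) : {set incidence G} :=
  [set i : incidence G |
    [exists u in neighbours v, val i == (u, [set u; v]%SET)]]%SET.

Definition ks_coloring (G : sgraph) (k s : nat)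
    (c : G + incidence G -> 'I_k) : Prop :=
  vi_coloring c /\ forall v : G, (#|[set c (inr i) | i in I2 v]%SET| <= s)%N.

Definition ks_colorable (G : sgraph) (s k : nat) : Prop :=
  exists c : G + incidence G -> 'I_k, ks_coloring s c.

(* The value 0 is only taken as a default when no (k, s)-coloring exists, which
   never happens for s > 0 : see ks_colorable_ex and chi_viP. *)
Definition chi_vi (G : sgraph) (s : nat) : nat :=
  if pselect (exists k, `[< ks_colorable G s k >]) is left h then ex_minn h
  else 0%N.

Lemma edgesP (G : sgraph) (e : {set G}) :
  reflect (exists x y, adj x y /\ e = [set x; y]%SET) (e \in edges G).
Proof.
apply: (iffP imset2P) => [[x y _]|[x [y [xy ->]]]].
  by rewrite inE => /andP[_ xy] ->; exists x, y.
by exists x y => //; rewrite inE.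
Qed.

Definition other_end (G : sgraph) (i : incidence G) : G :=
  odflt (val i).1 [pick y in (val i).2 :\ (val i).1]%SET.

Lemma other_endP (G : sgraph) (i : incidence G) :
  (val i).2 = [set (val i).1; other_end i]%SET /\ other_end i <> (val i).1.
Proof.
rewrite /other_end; case: i => -[u e] /= /andP[/edgesP[x [y [xy ->]]]].
have nxy : x != y by apply: contraTneq xy => ->; rewrite adj_irrefl.
rewrite !inE => /orP[]/eqP->; case: pickP => [z|H] /=.
- rewrite !inE => /andP[/negPf->] /= /eqP->.
  by split=> //; apply/eqP; rewrite eq_sym.
- by have := H y; rewrite !inE eqxx orbT andbT eq_sym nxy.
- rewrite !inE => /andP[/negPf->]; rewrite orbF => /eqP->.
  by rewrite finset.setUC; split=> //; apply/eqP.
- by have := H x; rewrite !inE eqxx nxy.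
Qed.

Lemma ks_colorable_ex (G : sgraph) (s : nat) :
  (0 < s)%N -> exists k, ks_colorable G s k.
Proof.
move=> s0; exists #|{: G + G}|.
pose f (x : G + incidence G) : G + G :=
  match x with inl v => inl v | inr i => inr (other_end i) end.
exists (enum_rank \o f); split=> [x y xy + /enum_rank_inj|v].
- case: x y xy => [u|i] [v|j] //= xy.
    by move=> _ [uv]; apply: xy; rewrite uv.
  move=> [q [pq lq sq]] [oij].
  have [ei ni] := other_endP i; have [ej nj] := other_endP j.
  have nij : (val i).1 <> (val j).1.
    move=> ij; apply: xy; congr inr; apply: val_inj.
    by rewrite [LHS]surjective_pairing [RHS]surjective_pairing ei ej ij oij.
  have neij : (val i).2 <> (val j).2.
    rewrite ei ej oij => /setP/(_ (val i).1); rewrite !inE eqxx /=.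
    by move/esym/orP=> [/eqP//|/eqP]; rewrite -oij => /esym.
  case: q pq lq sq => [_ /xy//|a [|b [|d [|//]]]] /=.
  + by move=> + aj _; rewrite aj andbT => /andP[/eqP].
  + move=> + bj _; rewrite bj; case: a => [v|a] /and3P[].
      by move=> /eqP iv /eqP jv _; apply: nij; rewrite iv jv.
    by move=> /andP[/eqP ea _] /andP[/eqP eb _] _; apply: neij; rewrite ea eb.
  + move=> + dj _; rewrite dj => /and4P[].
    case: a b => [v|a] [w|b] //=.
    * move=> /eqP iv /eqP bv /andP[/eqP eb _] _.
      have : (val i).1 \in (val j).2.
        by rewrite iv -bv -eb; case/andP: (valP b).
      by rewrite ej !inE => /orP[/eqP//|/eqP]; rewrite -oij => /esym.
    * move=> /andP[/eqP ea _] /eqP aw /eqP jw _.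
      have : (val j).1 \in (val i).2.
        by rewrite jw -aw ea; case/andP: (valP a).
      by rewrite ei !inE => /orP[/eqP/esym//|/eqP]; rewrite oij => /esym.
    * move=> /andP[/eqP ea _] /andP[/eqP eb _] /andP[/eqP ed _] _.
      by apply: neij; rewrite ea eb.
- apply: leq_trans s0; rewrite -(cards1 (enum_rank (inr v : G + G))).
  apply: subset_leq_card; apply/fintype.subsetP => _ /imsetP[i + ->].
  rewrite inE => /existsP[u /andP[uv /eqP iu]]; rewrite inE; apply/eqP.
  have [ei ni] := other_endP i.
  rewrite [LHS]/=; congr (enum_rank (inr _)).
  have : other_end i \in (val i).2 by rewrite ei set22.
  rewrite iu !inE => /orP[/eqP ou|/eqP//].
  by case: ni; rewrite ou iu.
Qed.

Lemma chi_viP (G : sgraph) (s : nat) : (0 < s)%N ->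
  ks_colorable G s (chi_vi G s) /\
  forall k, ks_colorable G s k -> (chi_vi G s <= k)%N.
Proof.
move=> s0; rewrite /chi_vi; case: pselect => [h|[]].
  case: ex_minnP => m /asboolP mP mmin; split=> // k kP.
  by apply: mmin; apply/asboolP.
by have [k kP] := ks_colorable_ex G s0; exists k; apply/asboolP.
Qed.

(* Main.v *)
(* Read the incidence [(v, vw)] as the arc [v -> w].  A (k,2)-colouring then
   assigns colours to vertices and arcs such that, at every vertex, its own
   colour, the colours of the outgoing arcs and the set of at most two colours
   of the incoming arcs are pairwise disjoint.

   Upper bound.  A theta subgraph whose three paths all have inner vertices
   cannot be drawn with all its vertices on the boundary of one face: joining a
   point of the face to the three paths would produce a drawing of K33.  Hence
   a longest cycle of a 2-connected outerplanar graph is Hamiltonian and its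
   chords do not cross, or the graph has four vertices.  Such a graph is built
   from a cycle by attaching ears over edges whose ends have degree 2; six
   colours suffice to extend a colouring over every ear as long as each edge
   that may later carry an ear stays [good], and the ear can be coloured so
   that all its inner edges are good.

   K33 is handled for arbitrary continua in place of arcs: approximating them
   by fine point sequences, the winding numbers (counted in quarter turns) of
   an edge around the vertices off it satisfy one relation for each of the
   eighteen pairs of disjoint edges, and these relations add up to 0 = 1 modulo
   2.

   Tightness.  The 4-cycle with one chord has no colouring with five colours:
   five colours force all arcs into a vertex of degree 3 to be equal. *)
Require Import Defs.
From mathcomp Require Import all_boot.
From mathcomp Require Import zify.
Set Implicit Arguments.
Unset Strict Implicit.
Unset Printing Implicit Defensive.

(** * Colouring a Hamiltonian cycle with non-crossing chords *)

Local Notation color := 'I_6.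

Definition palette : seq color :=
  [:: @Ordinal 6 0 isT; @Ordinal 6 1 isT; @Ordinal 6 2 isT;
      @Ordinal 6 3 isT; @Ordinal 6 4 isT; @Ordinal 6 5 isT].

Lemma mem_palette (x : color) : x \in palette.
Proof. by case: x => [[|[|[|[|[|[|]]]]]]]. Qed.

(* An edge [a - b] of a coloured path, read from [a] to [b]: the colours of [a],
   of [b], of the arc [a -> b] and of the arc [b -> a]. *)
Definition colored_edge : Type := (color * color * (color * color))%type.
Definition src (e : colored_edge) := e.1.1.
Definition dst (e : colored_edge) := e.1.2.
Definition fwd (e : colored_edge) := e.2.1.
Definition bwd (e : colored_edge) := e.2.2.

(* In [ok2] and [ok3], [c] is the colour of a vertex of degree 2 or 3, and the
   [o]s and [i]s are the colours of its outgoing and incoming arcs. *)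
Definition ok2 (T : eqType) (c o1 o2 i1 i2 : T) :=
  [&& uniq [:: c; o1; o2], i1 \notin [:: c; o1; o2] & i2 \notin [:: c; o1; o2]].

Definition ok3 (T : eqType) (c o1 o2 o3 i1 i2 i3 : T) :=
  [&& uniq [:: c; o1; o2; o3], i1 \notin [:: c; o1; o2; o3],
      i2 \notin [:: c; o1; o2; o3], i3 \notin [:: c; o1; o2; o3]
    & [|| i1 == i2, i1 == i3 | i2 == i3]].

Definition joint (e0 e1 : colored_edge) :=
  (dst e0 == src e1) && ok2 (src e1) (bwd e0) (fwd e1) (fwd e0) (bwd e1).

(* Over the edge [u - v] of a coloured path [u' - u - v - v'], the only
   obstruction to attaching an ear is the case excluded here (in fact a special
   case of it, and only for ears with a single inner vertex). *)
Definition good (e0 e1 e2 : colored_edge) :=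
  ~~ ((bwd e0 == dst e1) && (fwd e2 == src e1)).

(** Only inner edges have to be [good]: the two end edges of an ear meet an end of the carrying
    edge, whose degree is then already 3, so they never carry a further ear. *)
Fixpoint chain (es : seq colored_edge) : bool :=
  if es is e0 :: es' then
    (src e0 != dst e0) &&
    (if es' is e1 :: es'' then
       joint e0 e1 && (if es'' is e2 :: _ then good e0 e1 e2 else true)
     else true) && chain es'
  else true.

(* [es] colours an ear over the edge [u - v] of a path [u' - u - v - v'], where
   [y], [x], [w], [z], [f], [b] are the colours of the arcs [u -> u'],
   [u' -> u], [v -> v'], [v' -> v], [u -> v], [v -> u]. *)
Definition ear (u v y x w z : color) (f b : color) (es : seq colored_edge) :=
  let e0 := head (u, v, (f, b)) es in let e1 := last (u, v, (f, b)) es in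
  [&& src e0 == u, dst e1 == v, ok3 u y f (fwd e0) x b (bwd e0),
      ok3 v w b (bwd e1) z f (fwd e1) & chain es].

Definition relabel (h : color -> color) (e : colored_edge) : colored_edge :=
  (h (src e), h (dst e), (h (fwd e), h (bwd e))).

Lemma ok2_relabel (h : color -> color) c o1 o2 i1 i2 : injective h ->
  ok2 (h c) (h o1) (h o2) (h i1) (h i2) = ok2 c o1 o2 i1 i2.
Proof. by move=> hi; rewrite /ok2 /= !inE !(inj_eq hi). Qed.

Lemma ok3_relabel (h : color -> color) c o1 o2 o3 i1 i2 i3 : injective h ->
  ok3 (h c) (h o1) (h o2) (h o3) (h i1) (h i2) (h i3) =
  ok3 c o1 o2 o3 i1 i2 i3.
Proof. by move=> hi; rewrite /ok3 /= !inE !(inj_eq hi). Qed.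

Lemma chain_relabel (h : color -> color) es : injective h ->
  chain (map (relabel h) es) = chain es.
Proof.
move=> hi; elim: es => //= e0 [|e1 es] IH; rewrite !(inj_eq hi) //.
rewrite IH /joint /src /dst /fwd /bwd /= ok2_relabel // !(inj_eq hi).
by case: es {IH} => //= e2 es;
  rewrite /good /src /dst /fwd /bwd /= !(inj_eq hi).
Qed.

Lemma ear_relabel (h : color -> color) u v y x w z f b es : injective h ->
  ear (h u) (h v) (h y) (h x) (h w) (h z) (h f) (h b) (map (relabel h) es) =
  ear u v y x w z f b es.
Proof.
move=> hi; rewrite /ear chain_relabel //.
have -> : (h u, h v, (h f, h b)) = relabel h (u, v, (f, b)) by [].
have -> : head (relabel h (u, v, (f, b))) (map (relabel h) es) =
    relabel h (head (u, v, (f, b)) es) by case: es.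
rewrite last_map.
by rewrite !ok3_relabel // !(inj_eq hi).
Qed.

(** The given colours followed by the remaining ones list all six; matching this list with [palette]
    is a permutation. Up to renaming, the searches below may therefore fix the first few colours. *)
Lemma uniq_normalize (s : seq color) : uniq s ->
  exists h h' : color -> color,
    [/\ injective h, injective h', cancel h h', cancel h' h &
        map h s = take (size s) palette].
Proof.
move=> us; pose r := s ++ [seq x <- palette | x \notin s].
have ur : uniq r.
  by rewrite cat_uniq us filter_uniq // andbT; apply/hasPn => x;
    rewrite mem_filter => /andP[].
have mr x : x \in r.
  by rewrite mem_cat mem_filter mem_palette andbT orbN.
have sr : size r = size palette.
  rewrite -(card_uniqP ur) -[RHS](card_ord 6); apply: eq_card => x.
  by rewrite mr inE.
pose h x := nth ord0 palette (index x r).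
pose h' x := nth ord0 r (index x palette).
have hK : cancel h h'.
  move=> x; rewrite /h /h' index_uniq ?nth_index //.
  by rewrite -sr index_mem.
have hK' : cancel h' h.
  move=> x; rewrite /h /h' index_uniq ?nth_index ?mem_palette //.
  by rewrite sr index_mem mem_palette.
exists h, h'; split=> //; [exact: can_inj hK | exact: can_inj hK' |].
have ss : size s <= size palette by rewrite -sr size_cat leq_addr.
apply: (@eq_from_nth _ ord0); first by rewrite size_map size_takel.
rewrite size_map => i si; rewrite (nth_map ord0) // nth_take //.
by rewrite /h index_cat mem_nth // index_uniq.
Qed.

(** Quantifiers over an explicit list, so that the finite checks below evaluate by computation. *)
Definition some_color (P : pred color) := has P palette.
Definition all_colors (P : pred color) := all P palette.

Lemma some_colorP P : some_color P -> exists x, P x.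
Proof. by case/hasP => x _ Px; exists x. Qed.

Lemma all_colorsP P : all_colors P -> forall x, P x.
Proof. by move/allP => H x; apply: H; apply: mem_palette. Qed.

Local Notation "'K n" := (@Ordinal 6 n isT)
  (at level 8, n at level 2, format "''K' n").

(** The colours [f] and [g'] also stand in for the outer ends of the first and last edge, which
    matter only through being different from the inner ends. The [ok2] tests follow from [chain] and
    merely prune the search. *)
Definition linkable3 (b f g c f' g' : color) : bool :=
  some_color (fun f1 => ok2 b g f1 f f && some_color (fun g1 => ok2 b g f1 f g1 &&
  some_color (fun g2 => ok2 c g2 f' g' g' && some_color (fun f2 => ok2 c g2 f' f2 g' &&
  some_color (fun x => chain [:: (f, b, (f, g)); (b, x, (f1, g1)); (x, c, (f2, g2));
                          (c, g', (f', g'))]))))).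

Lemma linkable3_check :
  all_colors (fun c => all_colors (fun f' => (f' == c) || all_colors (fun g' =>
    (g' \in [:: c; f']) || linkable3 'K 0 'K 1 'K 2 c f' g'))).
Proof. by lazy. Qed.

(** Colours 0, 1, 2, 3 belong to [u], [v] and the arcs [u -> v], [v -> u]; [p] is the single inner
    vertex. The [ok3] tests again only prune. *)
Lemma ear1_check :
  all_colors (fun y => all_colors (fun x => ~~ ok2 'K 0 'K 2 y 'K 3 x ||
  all_colors (fun w => all_colors (fun z => [|| ~~ ok2 'K 1 'K 3 w 'K 2 z,
   (y == 'K 1) && (w == 'K 0) |
   some_color (fun g => ok3 'K 0 y 'K 2 g x 'K 3 'K 3 &&
   some_color (fun h => ok3 'K 0 y 'K 2 g x 'K 3 h &&
   some_color (fun g' => ok3 'K 1 w 'K 3 g' z 'K 2 'K 2 &&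
   some_color (fun h' => ok3 'K 1 w 'K 3 g' z 'K 2 h' &&
   some_color (fun p => ear 'K 0 'K 1 y x w z 'K 2 'K 3
     [:: ('K 0, p, (g, h)); (p, 'K 1, (h', g'))])))))])))).
Proof. by lazy. Qed.

Lemma ear2_check :
  all_colors (fun y => all_colors (fun x => ~~ ok2 'K 0 'K 2 y 'K 3 x ||
  all_colors (fun w => all_colors (fun z => ~~ ok2 'K 1 'K 3 w 'K 2 z ||
   some_color (fun g => ok3 'K 0 y 'K 2 g x 'K 3 'K 3 &&
   some_color (fun h => ok3 'K 0 y 'K 2 g x 'K 3 h &&
   some_color (fun g' => ok3 'K 1 w 'K 3 g' z 'K 2 'K 2 &&
   some_color (fun h' => ok3 'K 1 w 'K 3 g' z 'K 2 h' &&
   some_color (fun p => some_color (fun f1 => ok2 p h f1 g g &&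
   some_color (fun g1 => ok2 p h f1 g g1 && some_color (fun q =>
     ear 'K 0 'K 1 y x w z 'K 2 'K 3
       [:: ('K 0, p, (g, h)); (p, q, (f1, g1)); (q, 'K 1, (h', g'))])))))))))))).
Proof. by lazy. Qed.

Lemma ear_start_check :
  all_colors (fun y => all_colors (fun x => ~~ ok2 'K 0 'K 1 y 'K 2 x ||
   some_color (fun g => ok3 'K 0 y 'K 1 g x 'K 2 'K 2 && some_color (fun p =>
     uniq [:: 'K 0; p; g; 'K 2])))).
Proof. by lazy. Qed.

(** One end of a long ear: the ear arc entering the end vertex repeats the colour [e] of the arc
    entering it along the carrying edge, so at most two incoming colours occur. *)
Lemma ear_start (c d e y x : color) : ok2 c d y e x ->
  exists g p, ok3 c y d g x e e /\ uniq [:: c; p; g; e].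
Proof.
move=> oc; have us : uniq [:: c; d; e].
  move: oc; rewrite /ok2 /= !inE !negb_or => /and3P[/and3P[/andP[-> _] _ _]].
  by case/and3P=> ec ed _ _; rewrite (eq_sym c) (eq_sym d) ec ed.
have [h [h' [hi hi' hK hK']]] := uniq_normalize us; case=> hc hd he.
have := all_colorsP (all_colorsP ear_start_check (h y)) (h x).
rewrite -hc -hd -he ok2_relabel // oc /= => /some_colorP[g /andP[og /some_colorP[p up]]].
exists (h' g), (h' p); rewrite -(ok3_relabel _ _ _ _ _ _ _ hi) !hK'; split=> //.
have : uniq (map h [:: c; h' p; h' g; e]) by rewrite /= !hK'.
by rewrite (map_inj_uniq hi).
Qed.

Lemma chain_cons2 e0 e1 es : chain (e0 :: e1 :: es) =
  [&& src e0 != dst e0, joint e0 e1,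
     (if es is e2 :: _ then good e0 e1 e2 else true) & chain (e1 :: es)].
Proof. by rewrite /= -!andbA. Qed.

Lemma link3 e0 er : uniq [:: dst e0; fwd e0; bwd e0] -> src e0 != dst e0 ->
  uniq [:: src er; fwd er; bwd er] -> src er != dst er ->
  exists e1 e2, chain [:: e0; e1; e2; er].
Proof.
move=> u0 n0 u1 n1.
have [h [h' [hi hi' hK hK']]] := uniq_normalize u0.
case: e0 n0 u0 => -[a b] [f g] /=; rewrite /src /dst /fwd /bwd /= => n0 u0.
case: er n1 u1 => -[c d] [f' g'] /=; rewrite /src /dst /fwd /bwd /= => n1 u1.
case=> h0 h1 h2.
have := all_colorsP (all_colorsP linkable3_check (h c)) (h f').
rewrite (inj_eq hi); case: eqVneq => [fc|_ /= /all_colorsP/(_ (h g'))].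
  by move: u1; rewrite /= !inE fc eqxx.
rewrite !inE !(inj_eq hi); case: eqVneq => [gc|_ /=].
  by move: u1; rewrite /= !inE gc eqxx orbT.
case: eqVneq => [gf|_ /=]; first by move: u1; rewrite /= !inE gf eqxx andbF.
case/some_colorP=> f1 /andP[_ /some_colorP[g1 /andP[_ /some_colorP[g2 /andP[_ /some_colorP[f2]]]]]].
case/andP=> _ /some_colorP[x H].
exists (b, h' x, (h' f1, h' g1)), (h' x, c, (h' f2, h' g2)).
rewrite -[X in is_true X](chain_relabel [:: _; _; _; _] hi).
move: H; rewrite /= /relabel /joint /good /src /dst /fwd /bwd /= h0 h1 h2 !hK'.
by rewrite -h0 !(inj_eq hi) n0 n1 !eqxx /= => /and5P[-> -> -> _ _].
Qed.

(** The base case is [link3]. To lengthen, the next edge gives its new end and its two arcs the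
    three colours missing from [dst e0], [fwd e0], [bwd e0]. This always yields a joint, and the new
    edge is [good] because [bwd e0] differs from its new end. *)
Lemma link k e0 er : uniq [:: dst e0; fwd e0; bwd e0] -> src e0 != dst e0 ->
  uniq [:: src er; fwd er; bwd er] -> src er != dst er ->
  exists2 es, size es = k.+2 & chain (e0 :: rcons es er).
Proof.
elim: k e0 => [|k IH] e0 u0 n0 u1 n1.
  by have [e1 [e2 H]] := link3 u0 n0 u1 n1; exists [:: e1; e2].
have [h [h' [hi hi' hK hK']]] := uniq_normalize u0.
case=> h0 h1 h2.
pose e1 := (dst e0, h' 'K 3, (h' 'K 4, h' 'K 5)) : colored_edge.
have [||es ses ces] := IH e1 _ _ u1 n1.
- by rewrite /= !inE !(inj_eq hi').
- by rewrite /e1 /src /dst /= -(inj_eq hi) h0 hK'.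
exists (e1 :: es); first by rewrite /= ses.
rewrite rcons_cons chain_cons2 n0 ces andbT /=; apply/andP; split.
  rewrite /joint eqxx -(ok2_relabel _ _ _ _ _ hi) /=.
  by rewrite /src /fwd /bwd /= -/(dst e0) -/(bwd e0) -/(fwd e0) h0 h1 h2 !hK'.
case: (rcons es er) => // e2 _.
by rewrite /good negb_and -(inj_eq hi) h2 hK'.
Qed.

(** Here [k] counts inner vertices. One or two are settled by search; a longer ear is coloured at
    each end separately by [ear_start], and [link] joins the ends. *)
Lemma ear_exists k u v y x w z f b :
  0 < k -> u != v -> ok2 u f y b x -> ok2 v b w f z ->
  ~~ ((y == v) && (w == u)) ->
  exists2 es, size es = k.+1 & ear u v y x w z f b es.
Proof.
move=> k0 uv ou ov gd.
have us : uniq [:: u; v; f; b].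
  move: ou ov; rewrite /ok2 /= !inE !negb_or.
  case/and3P=> /and3P[/andP[uf _] _ _] /and3P[bu bf _] _.
  case/and3P=> /and3P[/andP[vb _] _ _] /and3P[fv _ _] _.
  by rewrite uv uf vb (eq_sym u) (eq_sym v) (eq_sym f b) bu bf fv.
have [h [h' [hi hi' hK hK']]] := uniq_normalize us; case=> hu hv hf hb.
suff [es ses H] : exists2 es, size es = k.+1 &
    ear 'K 0 'K 1 (h y) (h x) (h w) (h z) 'K 2 'K 3 es.
  exists (map (relabel h') es); first by rewrite size_map.
  rewrite -(hK u) -(hK v) -(hK y) -(hK x) -(hK w) -(hK z) -(hK f) -(hK b).
  by rewrite ear_relabel // hu hv hf hb.
move: ou ov gd; rewrite -(ok2_relabel _ _ _ _ _ hi) -(ok2_relabel v _ _ _ _ hi).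
rewrite -(inj_eq hi) -(inj_eq hi w) hu hv hf hb.
move: (h y) (h x) (h w) (h z) => {us hu hv hf hb uv}{}y {}x {}w {}z ou ov gd.
case: k k0 => // -[|[|k]] _.
- have := all_colorsP (all_colorsP ear1_check y) x;
    rewrite ou /= => /all_colorsP/(_ w).
  move/all_colorsP/(_ z); rewrite ov (negPf gd) /=.
  case/some_colorP=> g /andP[_ /some_colorP[g1 /andP[_ /some_colorP[g2 /andP[_ /some_colorP[g3]]]]]].
  by case/andP=> _ /some_colorP[p H]; eexists; last exact: H.
- have := all_colorsP (all_colorsP ear2_check y) x;
    rewrite ou /= => /all_colorsP/(_ w).
  move/all_colorsP/(_ z); rewrite ov /=.
  case/some_colorP=> g /andP[_ /some_colorP[g1 /andP[_ /some_colorP[g2 /andP[_ /some_colorP[g3]]]]]].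
  case/andP=> _ /some_colorP[p /some_colorP[f1 /andP[_ /some_colorP[f2 /andP[_ /some_colorP[q H]]]]]].
  by eexists; last exact: H.
- have [g [p [og up]]] := ear_start ou;
    have [g' [p' [og' up']]] := ear_start ov.
  pose e0 := ('K 0, p, (g, 'K 3)) : colored_edge.
  pose er := (p', 'K 1, ('K 2, g')) : colored_edge.
  have [||||es ses ces] := @link k e0 er.
  + by move: up; rewrite cons_uniq => /andP[].
  + by apply: contraTneq up; rewrite /src /dst /= => <-; rewrite inE eqxx.
  + by move: up'; rewrite /src /fwd /bwd /= !inE negb_or;
      do 6![case: eqVneq => //= _].
  + by apply: contraTneq up'; rewrite /src /dst /= => ->; rewrite inE eqxx.
  exists (e0 :: rcons es er); first by rewrite /= size_rcons ses.
  by rewrite /ear [last _ _]/= last_rcons; apply/and5P; split.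
Qed.

Lemma ok2_swap (T : eqType) (c o1 o2 i1 i2 : T) :
  ok2 c o1 o2 i1 i2 = ok2 c o2 o1 i2 i1.
Proof.
rewrite /ok2 /= !inE (eq_sym o2 o1) (orbC (c == o2)) andbCA andbC -!andbA.
rewrite (orbC (i1 == o2)) (orbC (i2 == o2)).
by do ![case: (_ || _) => //=|case: (_ == _) => //=].
Qed.

Lemma ok3_rev (T : eqType) (c o1 o2 o3 i1 i2 i3 : T) :
  ok3 c o1 o2 o3 i1 i2 i3 = ok3 c o3 o2 o1 i3 i2 i1.
Proof.
rewrite /ok3 /= !inE (eq_sym o3 o1) (eq_sym o3 o2) (eq_sym o2 o1).
rewrite (eq_sym i3 i1) (eq_sym i3 i2) (eq_sym i2 i1).
by do 12![case: (_ == _) => //=]; do ?[case: (_ == _) => //=].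
Qed.

Lemma colored_edge_eta (e : colored_edge) :
  (src e, dst e, (fwd e, bwd e)) = e.
Proof. by case: e => -[] ? ? []. Qed.

(* Vertices of the Hamiltonian cycle are numbered; [F t] and [B t] are the
   colours of the arcs [t -> t+1] and [t+1 -> t], and [G t] that of the arc from
   [t] to its chord partner [m t]; [m t = t] when [t] has no chord. *)
Record noncrossing (m : nat -> nat) : Prop := Noncrossing {
  mate_involutive : forall t, m (m t) = t;
  mate_nested : forall q t, q < t < m q -> q < m t < m q;
  mate_succ : forall t, m t != t.+1 }.

Definition vertex_ok (m : nat -> nat) (c F B G : nat -> color) (t : nat) :=
  if m t == t then ok2 (c t) (B t.-1) (F t) (F t.-1) (B t)
  else ok3 (c t) (B t.-1) (G t) (F t) (F t.-1) (G (m t)) (B t)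
       && (c t != c (m t)).

Definition edge_of (c F B : nat -> color) (t : nat) : colored_edge :=
  (c t, c t.+1, (F t, B t)).

Lemma vertex_ok_ext (m : nat -> nat) (c F B G c' F' B' G' : nat -> color) t :
  vertex_ok m c F B G t ->
  c' t = c t -> c' (m t) = c (m t) -> F' t = F t -> F' t.-1 = F t.-1 ->
  B' t = B t -> B' t.-1 = B t.-1 ->
  (m t != t -> G' t = G t /\ G' (m t) = G (m t)) ->
  vertex_ok m c' F' B' G' t.
Proof.
rewrite /vertex_ok => + -> -> -> -> -> ->.
by case: eqP => // /eqP tm + /(_ isT)[-> ->].
Qed.

(** Everything imposed from outside on the edge [i - j] is universally quantified, so the part
    beneath it can be coloured after the part outside. Letters are as in [ear]. *)
Definition fills (m : nat -> nat) (i j : nat) : Prop :=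
  forall u v y x w z f b,
  u != v -> ok2 u f y b x -> ok2 v b w f z -> ~~ ((y == v) && (w == u)) ->
  exists c F B G : nat -> color,
    [/\ c i = u /\ c j = v, ok3 u y f (F i) x b (B i),
        ok3 v w b (B j.-1) z f (F j.-1),
        forall t, i < t < j -> vertex_ok m c F B G t &
        forall t, i <= t < j -> c t != c t.+1].

(* [lia] splits on every boolean hypothesis, so those about colours are dropped
   first. *)
Ltac poslia := repeat match goal with
  | H : context [src] |- _ => clear H
  | H : context [ok2] |- _ => clear H
  | H : context [ok3] |- _ => clear H
  | H : context [chain] |- _ => clear H
  | H : context [joint] |- _ => clear H
  | H : context [good] |- _ => clear H
  | H : context [fills] |- _ => clear H
  end; lia.

(* [k] is the number of vertices, from [q] on, of the inner face that contains
   the path edge [q-1, q]. *)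
Lemma face_walk (m : nat -> nat) (q j : nat) : noncrossing m -> 0 < q <= j ->
  (forall t, q <= t < j -> q <= m t < j) ->
  (forall r s, q <= r -> r.+1 < s -> s < j ->
    (forall t, r < t < s -> r < m t < s) -> fills m r s) ->
  exists k, [/\ q < j -> 0 < k, q.+2 < j -> m q != j.-1 -> 2 < k, q.+1 < j -> 1 < k &
    forall e0 es, size es = k -> chain (e0 :: es) ->
    exists c F B G : nat -> color,
    [/\ edge_of c F B q.-1 = e0, edge_of c F B j.-1 = last e0 es,
        forall t, q <= t < j -> vertex_ok m c F B G t &
        forall t, q.-1 <= t < j -> c t != c t.+1]].
Proof.
move=> ncm; have [mK nest msucc] := ncm.
have [d] := ubnP (j - q); elim: d q => // d IH q ltd qj clo fil.
have [jq|ltqj] := leqP j q.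
  have jq' : j = q by poslia.
  subst j; exists 0; split; try by move=> *; poslia.
  move=> e0 [] // _ /= /andP[/andP[e0n _] _].
  (* No vertex is left: only the values describing the edge from [q.-1] to [q] matter, and [G] is a
     placeholder. *)
  exists (fun t => if t == q.-1 then src e0 else dst e0), (fun=> fwd e0), (fun=> bwd e0), (fun=> src e0).
  have h : (q.-1.+1 == q.-1) = false by poslia.
  rewrite /edge_of eqxx h colored_edge_eta; split=> //; first by move=> t;
    poslia.
  move=> t ht; have -> : t = q.-1 by poslia.
  by rewrite eqxx h.
have mq := clo q ltac:(poslia).
have [mqq|mqq] := eqVneq (m q) q.
  have clo' t : q < t < j -> q < m t < j.
    move=> ht; have := clo t ltac:(poslia).
    have : m t != q by apply/eqP => h; have := mK t; rewrite h mqq; poslia.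
    by poslia.
  have [||||k [k1 k3 k2 H]] := IH q.+1; [poslia|poslia|exact: clo'| |].
    by move=> r s h; apply: fil; poslia.
  exists k.+1; split; try by move=> *; poslia.
  move=> e0 [|e1 es] //= [ses]; rewrite -/(chain (e1 :: es)).
  case/andP=> /andP[e0n /andP[jo _]] ch.
  have [c [F [B [G [E1 E2 V D]]]]] := H e1 es ses ch.
  exists (fun t => if t == q.-1 then src e0 else c t), (fun t => if t == q.-1 then fwd e0 else F t),
    (fun t => if t == q.-1 then bwd e0 else B t), G.
  have h : (q.-1.+1 == q.-1) = false by poslia.
  have h' : (q == q.-1) = false by poslia.
  have hq : q.-1.+1 = q by poslia.
  have /andP[/eqP je jo'] := jo.
  have [E1a E1b E1c E1d] : [/\ c q = src e1, c q.+1 = dst e1, F q = fwd e1 & B q = bwd e1].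
    by rewrite -E1.
  split.
  - by rewrite /edge_of eqxx h hq E1a -je colored_edge_eta.
  - have hj : (j.-1 == q.-1) = false by poslia.
    have hj' : (j.-1.+1 == q.-1) = false by poslia.
    by rewrite -E2 /edge_of hj hj'.
  - move=> t ht; have [->|tq] := eqVneq t q.
      by rewrite /vertex_ok mqq eqxx h' eqxx E1a E1c E1d.
    have hm := clo' t ltac:(poslia).
    by apply: (vertex_ok_ext (V t _)) => //; rewrite ?ifN_eq //; poslia.
  - move=> t ht; have [->|tq] := eqVneq t q.-1.
      by rewrite h hq E1a -je.
    by rewrite ifN_eq ?D //; poslia.
(* The face leaves the path at [q] along the chord to [r]: [e1] colours that chord, [fil] colours
   what lies strictly between, and the induction resumes at [r.+1]. *)
set r := m q in mq mqq.
have mr : m r = q := mK q.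
have rq : q.+1 < r.
  by have := msucc q; rewrite -/r; poslia.
have inn t : q < t < r -> q < m t < r by exact: nest.
have clo' t : r < t < j -> r < m t < j.
  move=> ht; have := clo t ltac:(poslia).
  have : m t != q by apply/eqP => h; have := mK t; rewrite h -/r; poslia.
  have : m t != r by apply/eqP => h; have := mK t; rewrite h mr; poslia.
  have : ~~ (q < m t < r).
    by apply/negP => /inn; rewrite mK; poslia.
  by poslia.
have [||||k [k1 k3 k2 H]] := IH r.+1; [poslia|poslia|exact: clo'| |].
  by move=> r' s h; apply: fil; poslia.
exists k.+2; split; try by move=> *; poslia.
clear k1 k2 k3.
move=> e0 [|e1 [|e2 es]] // [ses].
rewrite !chain_cons2 => /and4P[e0n jo gd /and4P[e1n jo' _ ch]].
have [c2 [F2 [B2 [G2 [E1 E2 V2 D2]]]]] := H e2 es ses ch.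
have /andP[/eqP je jok] := jo; have /andP[/eqP je' jok'] := jo'.
have ou : ok2 (src e1) (fwd e1) (bwd e0) (bwd e1) (fwd e0) by rewrite ok2_swap.
have ov : ok2 (dst e1) (bwd e1) (fwd e2) (fwd e1) (bwd e2) by rewrite je'.
have [c1 [F1 [B1 [G1 [[c1q c1r] Oq Or V1 D1]]]]] :=
  fil q r (leqnn q) rq ltac:(poslia) inn _ _ _ _ _ _ _ _ e1n ou ov gd.
have [E1a E1b E1c E1d] : [/\ c2 r = src e2, c2 r.+1 = dst e2, F2 r = fwd e2 & B2 r = bwd e2].
  by rewrite -E1.
(* Three pieces: the given edge before [q], the filled ear from [q] to [r], the remaining walk from
   [r] on. The last two agree on the colour of [r]; the chord arcs enter [G] separately. *)
pose glue T (a : T) (A1 A2 : nat -> T) t := if t == q.-1 then a else if t < r then A1 t else A2 t.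
have glue0 T a A1 A2 : @glue T a A1 A2 q.-1 = a by rewrite /glue eqxx.
have glue1 T a A1 A2 t : q <= t < r -> @glue T a A1 A2 t = A1 t.
  by move=> ht; rewrite /glue ifN_eq; [case: ifP => //|]; poslia.
have glue2 T a A1 A2 t : r <= t -> @glue T a A1 A2 t = A2 t.
  by move=> ht; rewrite /glue ifN_eq; [case: ifP => //|]; poslia.
pose c := glue _ (src e0) c1 c2; pose F := glue _ (fwd e0) F1 F2.
pose B := glue _ (bwd e0) B1 B2.
pose G t := if t == q then fwd e1 else if t == r then bwd e1 else if t < r then G1 t else G2 t.
have cr : c r = c1 r by rewrite /c glue2 // E1a c1r.
have Gq : G q = fwd e1 by rewrite /G eqxx.
have Gr : G r = bwd e1 by rewrite /G (negPf mqq) eqxx.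
have c_1 t : q <= t <= r -> c t = c1 t.
  by move=> ht; have [->//|tr] := eqVneq t r; rewrite /c glue1 //; poslia.
have G_1 t : q < t < r -> G t = G1 t.
  move=> ht; rewrite /G; do 2![case: eqP => [|_]; first by clear -ht; poslia].
  by case: ltnP => //; clear -ht; poslia.
have G_2 t : r < t -> G t = G2 t.
  move=> ht; rewrite /G;
    do 2![case: eqP => [|_]; first by clear -ht rq; poslia].
  by case: ltnP => //; clear -ht; poslia.
have hq : q.-1.+1 = q by poslia.
exists c, F, B, G; split.
- by rewrite /edge_of /c /F /B !glue0 hq glue1 ?c1q -?je ?colored_edge_eta //;
    poslia.
- by rewrite [last _ _]/= -E2 /edge_of /c /F /B !glue2 //; poslia.
- move=> t ht; have [->|tq] := eqVneq t q.
    rewrite /vertex_ok -/r (negPf mqq) Gq Gr cr c_1 ?c1q ?c1r ?e1n ?andbT;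
      last by poslia.
    by rewrite /F /B !glue0 !glue1 //; poslia.
  have [->|tr] := eqVneq t r.
    rewrite /vertex_ok mr eq_sym (negPf mqq) Gq Gr cr c_1 ?c1q ?c1r 1?eq_sym ?e1n ?andbT; last by poslia.
    rewrite ok3_rev /F /B (glue1 _ _ _ _ r.-1) ?(glue1 _ _ _ _ r.-1) ?glue2 ?E1c ?E1d //; poslia.
  have [ltr|ger] := ltnP t r.
    have hm := inn t ltac:(poslia).
    apply: (vertex_ok_ext (V1 t _)); rewrite ?c_1 /F /B ?glue1 //; try poslia.
    by move=> _; rewrite !G_1 //; clear -ht tq ltr; poslia.
  have hm := clo' t ltac:(poslia).
  apply: (vertex_ok_ext (V2 t _)); rewrite /c /F /B ?glue2 //; try poslia.
  by move=> _; rewrite !G_2 //; clear -hm tr ger rq; poslia.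
- move=> t ht; have [->|tq] := eqVneq t q.-1.
    by rewrite hq (c_1 q) ?c1q -?je /c ?glue0 //; poslia.
  have [ltr|ger] := ltnP t r; first by rewrite !c_1 ?D1 //; poslia.
  by rewrite /c !glue2 ?D2 //; poslia.
Qed.

(** Strong induction on [j - i]: [ear_exists] colours the boundary of the face beneath [i - j],
    [face_walk] spreads this colouring, and shorter chords on that boundary are filled by
    induction. *)
Lemma noncrossing_fills (m : nat -> nat) (i j : nat) : noncrossing m ->
  i.+1 < j -> (forall t, i < t < j -> i < m t < j) -> fills m i j.
Proof.
move=> ncm; have [d] := ubnP (j - i).
elim: d i j => // d IH i j ltd ij clo u v y x w z f b uv ou ov gd.
have [|||k [k1 _ _ H]] := @face_walk m i.+1 j ncm; [poslia|exact: clo| |].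
  by move=> r s h1 h2 h3 h4; apply: IH => //; poslia.
have [[|e0 es] //= [ses]] := ear_exists (k1 ij) uv ou ov gd.
case/and5P=> /eqP se /eqP de oku okv ch.
have [c [F [B [G [E1 E2 V D]]]]] := H e0 es ses ch.
exists c, F, B, G; move: se de oku okv;
  rewrite [head _ _]/= [last _ _]/= -E2 -E1.
rewrite /edge_of /src /dst /fwd /bwd /= (ltn_predK ij) => se de oku okv.
by split.
Qed.

Lemma noncrossing_cycle_coloring (m : nat -> nat) (n : nat) : noncrossing m ->
  2 < n -> (forall t, 0 < t <= n -> 0 < m t <= n) -> m 1 != n ->
  exists c F B G : nat -> color,
    [/\ edge_of c F B 0 = edge_of c F B n,
        forall t, 0 < t <= n -> vertex_ok m c F B G t &
        forall t, 0 < t <= n -> c t != c t.+1].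
Proof.
move=> ncm n2 clo m1.
have [|||k [_ k3 _ H]] := @face_walk m 1 n.+1 ncm; [by []|exact: clo| |].
  by move=> r s _ h1 _ h2; apply: noncrossing_fills.
have := k3 ltac:(poslia) m1; case: k {k3} H => // -[|[|k]] // H _.
(* The cycle is cut open at its closing edge, read both as [0 - 1] and as [n - n.+1]; a chain that
   starts and ends with the same [e0] makes both readings agree. The face has at least three
   vertices, enough for [link]. *)
pose e0 := ('K 0, 'K 1, ('K 2, 'K 3)) : colored_edge.
have [||||es ses ch] := @link k e0 e0 => //.
have [|c [F [B [G [E1 E2 V D]]]]] := H e0 (rcons es e0) _ ch.
  by rewrite size_rcons ses.
exists c, F, B, G; split=> //; first by rewrite E1 E2 last_rcons.
by move=> t ht; apply: D; poslia.
Qed.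

(** * From arc colourings to vi-simultaneous colourings *)

Lemma edge_adj (G : sgraph) (u v : G) :
  ([set u; v] \in edges G) = adj u v.
Proof.
apply/idP/idP => [/edgesP[x [y [xy e]]]|uv]; last by apply/edgesP; exists u, v.
have : x \in [set u; v] by rewrite e !inE eqxx.
have : y \in [set u; v] by rewrite e !inE eqxx orbT.
have nxy : x != y by apply: contraTneq xy => ->; rewrite adj_irrefl.
rewrite !inE => /orP[]/eqP yE /orP[]/eqP xE; rewrite yE xE in xy nxy => //.
- by rewrite eqxx in nxy.
- by rewrite adj_sym.
- by rewrite eqxx in nxy.
Qed.

Lemma incidence_adj (G : sgraph) (i : incidence G) :
  adj (val i).1 (other_end i).
Proof.
have [e _] := other_endP i; rewrite -edge_adj -e.
by case/andP: (valP i).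
Qed.

Lemma incidence_eq (G : sgraph) (i j : incidence G) :
  (val i).1 = (val j).1 -> other_end i = other_end j -> i = j.
Proof.
move=> t h; apply: val_inj; have [ei _] := other_endP i;
  have [ej _] := other_endP j.
by rewrite [LHS]surjective_pairing [RHS]surjective_pairing ei ej t h.
Qed.

Lemma incidence_rev (G : sgraph) (i j : incidence G) :
  subdiv3_adj (inr i) (inr j) ->
  (val j).1 = other_end i /\ other_end j = (val i).1.
Proof.
move=> /= /andP[/eqP e /eqP tn]; have [ei ni] := other_endP i.
have [ej nj] := other_endP j; rewrite ei ej in e.
have : (val j).1 \in [set (val j).1; other_end j] by rewrite !inE eqxx.
rewrite -e !inE => /orP[/eqP h|/eqP h]; first by case: tn.
have : other_end j \in [set (val j).1; other_end j] by rewrite !inE eqxx orbT.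
by rewrite -e !inE => /orP[/eqP->//|/eqP h']; case: nj; rewrite h h'.
Qed.

Lemma mk_incidence (G : sgraph) (u v : G) : adj u v ->
  exists i : incidence G, val i = (u, [set u; v]) /\ other_end i = v.
Proof.
move=> uv; have iP : ([set u; v] \in edges G) && (u \in [set u; v]).
  by rewrite edge_adj uv !inE eqxx.
pose i : incidence G := Sub (u, [set u; v]) iP; exists i; split;
  first by rewrite SubK.
have [] := other_endP i; rewrite SubK /= => e n.
have : other_end i \in [set u; other_end i] by rewrite !inE eqxx orbT.
by rewrite -e !inE => /orP[/eqP|/eqP].
Qed.

(* Elements at distance at most 3 in [subdiv3 G]; an incidence [(v, vw)] is
   regarded as the arc from [v] to [w]. *)
Definition interfere (G : sgraph) (x y : G + incidence G) : Prop :=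
  match x, y with
  | inl u, inl v => u = v \/ adj u v
  | inl v, inr i | inr i, inl v => (val i).1 = v \/ other_end i = v
  | inr i, inr j => [\/ (val j).1 = (val i).1, other_end j = (val i).1 |
                        (val j).1 = other_end i]
  end.

Lemma dist3_interfere (G : sgraph) (x y : subdiv3 G) :
  dist_le 3 x y -> interfere x y.
Proof.
move=> [p [px ly sp]].
have [->|[z xz [zy|[w zw [wy|wy]]]]] : x = y \/ exists2 z, adj x z &
    (z = y \/ exists2 w, adj z w & (w = y \/ adj w y)).
  case: p px ly sp => [|a [|b [|c [|//]]]] /=.
  - by move=> _ -> _; left.
  - by rewrite andbT => xa <- _; right; exists a => //; left.
  - by case/and3P=> xa ab _ <- _; right; exists a => //; right; exists b => //;
      left.
  - by case/and4P=> xa ab bc _ <- _; right; exists a => //; right;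
      exists b => //; right.
- by case: y {ly} => [u|i]; [left|constructor 1].
- subst z; case: x y {px ly} xz => [u|i] [v|j] //=; try by move/eqP; left.
  by move/(@incidence_rev _ i j) => [h1 h2]; constructor 2.
- subst w; case: x z {px ly} xz zw => [u|i] [v|j] //= /=.
  + move=> /eqP ji; case: y => [v|k] /=; first by move=> /eqP <-; left.
    by move/(@incidence_rev _ j k) => [h1 h2]; right; rewrite h2.
  + by move=> /eqP iv; case: y => [//|k] /eqP kv; constructor 1; rewrite kv.
  + move/(@incidence_rev _ i j) => [h1 h2]; case: y => [v|k] /=.
      by move/eqP <-; right.
    by move/(@incidence_rev _ j k) => [h3 h4]; constructor 1; rewrite h3.
- case: x z {px ly} xz zw => [u|i] [v|j] //= /=.
  + move=> /eqP ji; case: w wy => [v|k] /=.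
      by move=> + /eqP jv; case: y => [//|k] /eqP kv; left; rewrite kv -jv.
    move=> + /(@incidence_rev _ j k)[h1 h2]; case: y => [v|l] /=.
      by move=> /eqP <-; right; rewrite h1 -ji; exact: incidence_adj.
    by move/(@incidence_rev _ k l) => [h3 h4]; left; rewrite h3 h2.
  + move=> /eqP iv; case: w wy => [//|k] + /eqP kv.
    case: y => [v'|l] /=; first by move/eqP=> <-; left; rewrite kv.
    by move/(@incidence_rev _ k l) => [h3 h4]; constructor 2; rewrite h4 kv.
  + move/(@incidence_rev _ i j) => [h1 h2]; case: w wy => [v|k] /=.
      by case: y => [//|l] /= /eqP lv /eqP jv; constructor 3; rewrite lv -jv.
    move=> + /(@incidence_rev _ j k)[h3 h4].
    case: y => [v|l] /=; first by move/eqP<-; left; rewrite h3.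
    by move/(@incidence_rev _ k l) => [h5 h6]; constructor 2; rewrite h6 h3.
Qed.

(** The case [w = v] of the second hypothesis separates the two arcs of an edge; the last hypothesis
    bounds the colours on [I2 v], the arcs into [v]. *)
Lemma arc_coloring_colorable (G : sgraph) (k : nat) (C : G -> 'I_k)
    (a : G -> G -> 'I_k) :
  (forall u v, adj u v -> [/\ C u <> C v, C u <> a u v & C u <> a v u]) ->
  (forall u v w, adj u v -> adj u w -> a u v <> a w u) ->
  (forall u v w, adj u v -> adj u w -> v <> w -> a u v <> a u w) ->
  (forall v, exists x y, forall u, adj v u -> a u v \in [:: x; y]) ->
  ks_colorable G 2 k.
Proof.
move=> hC hio hoo hin.
exists (fun x => match x with inl v => C v | inr i => a (val i).1 (other_end i) end).
split.
- move=> x y xy /dist3_interfere; case: x y xy => [u|i] [v|j] xy /=.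
  + by case=> [uv|/hC[]//]; case: xy; rewrite uv.
  + have ij := incidence_adj j; case=> <-; first by have [] := hC _ _ ij.
    by rewrite adj_sym in ij; have [] := hC _ _ ij.
  + have ij := incidence_adj i; case=> <- /esym; first by have [] := hC _ _ ij.
    by rewrite adj_sym in ij; have [] := hC _ _ ij.
  + have ai := incidence_adj i; have aj := incidence_adj j; case=> h.
    * rewrite h in aj *; apply: hoo => // h'; apply: xy; congr inr.
      exact: incidence_eq.
    * by rewrite h in aj *; apply: hio => //; rewrite adj_sym.
    * by rewrite h in aj *; apply/nesym; apply: hio => //; rewrite adj_sym.
- move=> v; have [x [y H]] := hin v.
  apply: (@leq_trans #|[set x; y]|); last by rewrite cards2; case: (_ != _).
  apply: subset_leq_card; apply/subsetP => _ /imsetP[i + ->].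
  rewrite inE => /existsP[u /andP[uv /eqP iu]].
  have -> : other_end i = v.
    have [ei ni] := other_endP i.
    have : other_end i \in (val i).2 by rewrite ei !inE eqxx orbT.
    by rewrite iu !inE => /orP[/eqP h|/eqP//]; case: ni; rewrite iu h.
  by rewrite iu; have := H u; rewrite !inE; apply; move: uv; rewrite inE.
Qed.

Lemma cycle_nth (T : eqType) (e : rel T) (x0 : T) (s : seq T) i :
  cycle e s -> i < size s ->
  e (nth x0 s i) (nth x0 s (if i.+1 == size s then 0 else i.+1)).
Proof.
case: s => // h s /= /pathP => /(_ x0) H si.
have := H i; rewrite size_rcons => /(_ si).
rewrite -rcons_cons !nth_rcons /= si eqSS; case: eqP => [->|/eqP ne].
  by rewrite ltnn ?eqxx.
by have -> : i < size s by lia.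
Qed.

Lemma ok3_uniq (T : eqType) (c o1 o2 o3 i1 i2 i3 : T) : ok3 c o1 o2 o3 i1 i2 i3 ->
  [/\ forall o, o \in [:: o1; o2; o3] -> c <> o, forall i, i \in [:: i1; i2; i3] -> c <> i,
      forall o i, o \in [:: o1; o2; o3] -> i \in [:: i1; i2; i3] -> o <> i,
      uniq [:: o1; o2; o3] &
      exists x y, forall i, i \in [:: i1; i2; i3] -> i \in [:: x; y]].
Proof.
rewrite /ok3 cons_uniq => /and5P[/andP[cn uo] h1 h2 h3 h].
have hi i : i \in [:: i1; i2; i3] -> i \notin [:: c; o1; o2; o3].
  move=> hi; have : [|| i == i1, i == i2 | i == i3] by move: hi; rewrite !inE.
  by case/or3P=> /eqP->.
split=> //.
- by move=> o ho e; rewrite e ho in cn.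
- by move=> i /hi + e; rewrite -e inE eqxx.
- by move=> o i ho /hi + e; rewrite -e inE ho orbT.
- case/or3P: h => /eqP e.
  + by exists i1, i3 => i; rewrite e !inE => /or3P[]->; rewrite ?orbT.
  + by exists i1, i2 => i; rewrite -e !inE => /or3P[]->; rewrite ?orbT.
  + by exists i1, i2 => i; rewrite -e !inE => /or3P[]->; rewrite ?orbT.
Qed.

Lemma ok2_uniq (T : eqType) (c o1 o2 i1 i2 : T) : ok2 c o1 o2 i1 i2 ->
  [/\ forall o, o \in [:: o1; o2] -> c <> o, forall i, i \in [:: i1; i2] -> c <> i,
      forall o i, o \in [:: o1; o2] -> i \in [:: i1; i2] -> o <> i & uniq [:: o1; o2]].
Proof.
rewrite /ok2 cons_uniq => /and3P[/andP[cn uo] h1 h2].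
have hi i : i \in [:: i1; i2] -> i \notin [:: c; o1; o2].
  move=> hi; have : (i == i1) || (i == i2) by move: hi; rewrite !inE.
  by case/orP=> /eqP->.
split=> //.
- by move=> o ho e; rewrite e ho in cn.
- by move=> i /hi + e; rewrite -e inE eqxx.
- by move=> o i ho /hi + e; rewrite -e inE ho orbT.
Qed.

(** Vertices get positions 1 to [n] along the cycle. Degree at most 3 leaves at most one chord per
    vertex, so the chords define an involution [m] on positions to which
    [noncrossing_cycle_coloring] applies. *)
Lemma hamiltonian_colorable (G : sgraph) (x0 : G) (s : seq G) :
  cycle (@adj G) s -> uniq s -> (forall x, x \in s) -> 2 < size s ->
  (forall v : G, #|neighbours v| <= 3) ->
  (forall i j k l, i < j < k -> k < l < size s ->
     adj (nth x0 s i) (nth x0 s k) -> ~~ adj (nth x0 s j) (nth x0 s l)) ->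
  ks_colorable G 2 6.
Proof.
move=> cs us als n2 deg nocross; set n := size s in n2;
  have nE : n = size s by []; clearbody n.
pose vt t := nth x0 s t.-1; pose pos v := (index v s).+1.
have posP v : 0 < pos v <= n by rewrite /pos /= nE index_mem.
have vtK v : vt (pos v) = v by rewrite /vt /= nth_index.
have posK t : 0 < t <= n -> pos (vt t) = t.
  by case/andP=> t0 tn; rewrite /pos /vt index_uniq ?prednK -?nE.
pose nxt t := if t == n then 1 else t.+1.
pose prv t := if t == 1 then n else t.-1.
have nxtP t : 0 < t <= n -> 0 < nxt t <= n by rewrite /nxt; case: eqP; lia.
have prvP t : 0 < t <= n -> 0 < prv t <= n by rewrite /prv; case: eqP; lia.
have prvK t : 0 < t <= n -> nxt (prv t) = t.
  by rewrite /prv; case: (t =P 1) => [->|t1] ht; rewrite /nxt ?eqxx //;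
    case: eqP; lia.
have nxtK t : 0 < t <= n -> prv (nxt t) = t.
  by rewrite /nxt; case: (t =P n) => [->|tn] ht; rewrite /prv ?eqxx //;
    case: eqP; lia.
have np t : 0 < t <= n -> nxt t != prv t.
  by rewrite /nxt /prv; case: (t =P n); case: (t =P 1); lia.
have adjn t : 0 < t <= n -> adj (vt t) (vt (nxt t)).
  case/andP=> t0 tn; have := @cycle_nth _ _ x0 s t.-1 cs; rewrite -nE prednK //.
  by move=> /(_ tn); rewrite /vt /nxt; case: eqP.
pose chord t t' := [&& 0 < t <= n, 0 < t' <= n, adj (vt t) (vt t'), t' != nxt t & t != nxt t'].
have chordC t t' : chord t t' = chord t' t.
  by rewrite /chord adj_sym; do 5!bool_congr.
(* Two chords at [t] together with its two cycle neighbours would make four neighbours. *)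
have chordU t t1 t2 : chord t t1 -> chord t t2 -> t1 = t2.
  move=> /and5P[ht h1 a1 b1 c1] /and5P[_ h2 a2 b2 c2]; apply/eqP;
    apply: contraT => n12.
  have := deg (vt t); rewrite leqNgt => /negP[].
  pose q := [:: vt (nxt t); vt (prv t); vt t1; vt t2].
  have uq : uniq q.
    have -> : q = map vt [:: nxt t; prv t; t1; t2] by [].
    rewrite map_inj_in_uniq; last first.
      have ran x : x \in [:: nxt t; prv t; t1; t2] -> 0 < x <= n.
        by rewrite !inE => /or4P[]/eqP->;
          [exact: nxtP|exact: prvP|exact: h1|exact: h2].
      by move=> x y /ran hx /ran hy /(congr1 pos); rewrite !posK.
    have p1 : t1 != prv t by apply: contraNneq c1 => ->; rewrite prvK.
    have p2 : t2 != prv t by apply: contraNneq c2 => ->; rewrite prvK.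
    rewrite /= !inE !negb_or np // (eq_sym (nxt t)) b1 (eq_sym (nxt t) t2) b2.
    by rewrite (eq_sym (prv t)) p1 (eq_sym (prv t) t2) p2 n12.
  rewrite -[4]/(size q) -(card_uniqP uq); apply: subset_leq_card;
    apply/subsetP => x.
  rewrite !inE => /or4P[]/eqP-> //; first exact: adjn.
  by rewrite adj_sym -[X in adj _ (vt X)]prvK // adjn // prvP.
(* Chords join positions from 1 to [n], so [m] is the identity elsewhere, in particular at 0. *)
pose m t := if [pick t' : 'I_n.+1 | chord t t'] is Some t' then val t' else t.
have chordE t t' : chord t t' -> m t = t'.
  move=> h; rewrite /m; case: pickP => [t'' h''|H]; first exact: chordU h'' h.
  have t'n : t' < n.+1 by case/and5P: h => _; lia.
  by have := H (Ordinal t'n); rewrite /= h.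
have mchord t : m t != t -> chord t (m t).
  by rewrite /m; case: pickP => [t' //|_]; rewrite eqxx.
have mK t : m (m t) = t.
  have [e|/mchord h] := eqVneq (m t) t; first by rewrite !e.
  by apply: chordE; rewrite chordC.
have mran t : 0 < t <= n -> 0 < m t <= n.
  by have [->//|/mchord/and5P[]] := eqVneq (m t) t.
have cross i j k l : 0 < i -> i < j < k -> k < l <= n -> chord i k -> ~~ chord j l.
  move=> i0 ijk kln /and5P[_ _ ik _ _]; apply/negP => /and5P[_ _ jl _ _].
  have := nocross i.-1 j.-1 k.-1 l.-1;
    rewrite -/(vt i) -/(vt j) -/(vt k) -/(vt l) ik jl.
  by move=> H; have := H ltac:(lia) ltac:(lia) isT.
have ncm : noncrossing m.
  split=> //.
  - move=> q t qt; have /mchord cq : m q != q by lia.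
    have [->//|mt] := eqVneq (m t) t; have ct := mchord t mt.
    have mtq : m t != q by apply/eqP => e; have := mK t; rewrite e; lia.
    have mtmq : m t != m q by apply/eqP => e; have := mK t; rewrite e mK; lia.
    have [q0 qn] : 0 < q <= n /\ 0 < m q <= n by case/and5P: cq.
    have [_ tn] : 0 < t <= n /\ 0 < m t <= n by case/and5P: ct.
    have [lt1|ge1] := ltnP (m t) q.
      have := cross (m t) q t (m q); rewrite cq chordC ct => H.
      by have := H ltac:(lia) ltac:(lia) ltac:(lia) isT.
    have [lt2|ge2] := ltnP (m q) (m t); last by lia.
    have := cross q t (m q) (m t); rewrite cq ct => H.
    by have := H ltac:(lia) ltac:(lia) ltac:(lia) isT.
  - move=> t; apply/eqP => e; have := mchord t; rewrite e => /(_ ltac:(lia)).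
    by case/and5P=> ht ht' _ + _; rewrite /nxt; case: (t =P n); lia.
have m1n : m 1 != n.
  apply/eqP => e; have := mchord 1; rewrite e => /(_ ltac:(lia)).
  by case/and5P=> _ _ _ _; rewrite /nxt eqxx.
have [c [F [B [Gc [E0 V D]]]]] := noncrossing_cycle_coloring ncm n2 mran m1n.
have [c0n c1n F0n B0n] : [/\ c 0 = c n, c 1 = c n.+1, F 0 = F n & B 0 = B n].
  by case: E0.
pose arc v u := if pos u == nxt (pos v) then F (pos v)
  else if pos v == nxt (pos u) then B (pos u) else Gc (pos v).
have Fp t : 0 < t <= n -> F t.-1 = F (prv t) by rewrite /prv;
  case: eqP => [->|].
have Bp t : 0 < t <= n -> B t.-1 = B (prv t) by rewrite /prv;
  case: eqP => [->|].
have cnx t : 0 < t <= n -> c t != c (nxt t).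
  by move=> ht; have := D t ht; rewrite /nxt; case: (t =P n) => [->|//];
    rewrite c1n.
have nbr v u : adj v u -> let t := pos v in
    [\/ [/\ pos u = nxt t, arc v u = F t & arc u v = B t],
        [/\ pos u = prv t, arc v u = B (prv t) & arc u v = F (prv t)] |
        [/\ pos u = m t, m t != t, arc v u = Gc t & arc u v = Gc (m t)]].
  move=> vu t; have ht := posP v; have hu := posP u.
  have [e|ne] := eqVneq (pos u) (nxt t).
    constructor 1; rewrite /arc e eqxx; split=> //.
    rewrite -/t (_ : (t == nxt (nxt t)) = false) //; apply/negbTE/eqP => e'.
    by have := np t ht; rewrite {2}e' nxtK ?eqxx // nxtP.
  have [e|ne'] := eqVneq t (nxt (pos u)).
    have ep : pos u = prv t by rewrite e nxtK.
    by constructor 2; rewrite /arc (negPf ne) -/t e eqxx nxtK // -e.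
  have ch : chord t (pos u) by rewrite /chord ht hu !vtK vu ne ne'.
  have em := chordE _ _ ch; constructor 3;
    rewrite /arc em (negPf ne) -/t (negPf ne'); split=> //.
  by apply: contraTneq vu => e; rewrite -(vtK v) -(vtK u) e adj_irrefl.
have posI u w : pos u = pos w -> u = w by move=> e; rewrite -(vtK u) e vtK.
have local v : [/\ forall u, adj v u -> c (pos v) <> c (pos u),
    forall u, adj v u -> c (pos v) <> arc v u /\ c (pos v) <> arc u v,
    forall u w, adj v u -> adj v w -> arc v u <> arc w v,
    forall u w, adj v u -> adj v w -> u <> w -> arc v u <> arc v w &
    exists x y, forall u, adj v u -> arc u v \in [:: x; y]].
  have ht := posP v; have := V _ ht; rewrite /vertex_ok Fp // Bp //.
  have cp : c (pos v) != c (prv (pos v)).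
    by rewrite eq_sym -{2}(prvK _ ht) cnx // prvP.
  case: ifPn => [/eqP mt /ok2_uniq[cO cI OI uO]|mt /andP[/ok3_uniq[cO cI OI uO [x [y xy]]] cm]].
    have M u : adj v u -> [/\ arc v u \in [:: B (prv (pos v)); F (pos v)],
        arc u v \in [:: F (prv (pos v)); B (pos v)] & c (pos v) <> c (pos u)].
      case/nbr=> [[-> -> ->]|[-> -> ->]|[_]]; last by rewrite mt eqxx.
        by rewrite !inE !eqxx !orbT; split=> //; apply/eqP/cnx.
      by rewrite !inE !eqxx; split=> //; apply/eqP.
    split.
    - by move=> u /M[].
    - by move=> u /M[h1 h2 _]; split; [exact: cO|exact: cI].
    - by move=> u w /M[h1 _ _] /M[_ h2 _]; exact: OI.
    - move=> u w /nbr[[e1 -> _]|[e1 -> _]|[_]];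
        rewrite ?mt ?eqxx // => /nbr[[e2 -> _]|[e2 -> _]|[_]];
        rewrite ?mt ?eqxx // => uw e; try by apply: uw; apply: posI;
          rewrite e1 e2.
        by move: uO; rewrite e /= inE eqxx.
      by move: uO; rewrite e /= inE eqxx.
    - by exists (F (prv (pos v))), (B (pos v)) => u /M[].
  have M u : adj v u -> [/\ arc v u \in [:: B (prv (pos v)); Gc (pos v); F (pos v)],
      arc u v \in [:: F (prv (pos v)); Gc (m (pos v)); B (pos v)] & c (pos v) <> c (pos u)].
    case/nbr=> [[-> -> ->]|[-> -> ->]|[-> _ -> ->]]; rewrite !inE !eqxx ?orbT;
      split=> //.
    - exact/eqP/cnx.
    - exact/eqP.
    - exact/eqP.
  split.
  - by move=> u /M[].
  - by move=> u /M[h1 h2 _]; split; [exact: cO|exact: cI].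
  - by move=> u w /M[h1 _ _] /M[_ h2 _]; exact: OI.
  - move=> u w /nbr[[e1 -> _]|[e1 -> _]|[e1 _ -> _]] /nbr[[e2 -> _]|[e2 -> _]|[e2 _ -> _]] uw e;
      try (by apply: uw; apply: posI; rewrite e1 e2);
      by move: uO; rewrite e /= !inE !eqxx ?orbT ?andbF.
  - by exists x, y => u /M[_ h _]; exact: xy.
apply: (@arc_coloring_colorable G 6 (fun v => c (pos v)) arc).
- move=> u v uv; have [h1 h2 _ _ _] := local u; have [] := h2 v uv.
  by split=> //; exact: h1.
- by move=> u v w uv uw; have [_ _ h _ _] := local u; exact: h.
- by move=> u v w uv uw; have [_ _ _ h _] := local u; exact: h.
- by move=> v; have [_ _ _ _ h] := local v.
Qed.

(* Colour of the arc [i -> j] of K4 when vertex [i] has colour [i]; the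
   diagonal is irrelevant. *)
Definition K4_arc (i j : nat) : nat :=
  nth 0 (nth [::] [:: [:: 0; 3; 4; 5]; [:: 2; 0; 4; 5];
                      [:: 1; 0; 0; 5]; [:: 1; 0; 4; 0]] i) j.

(** The arc colouring of K4 restricts to every graph on four vertices. This covers the only case in
    which chords of the Hamiltonian cycle may cross. *)
Lemma four_vertices_colorable (G : sgraph) : #|G| = 4 -> ks_colorable G 2 6.
Proof.
move=> c4; pose r (v : G) : nat := enum_rank v.
have r4 v : r v < 4 by rewrite -[4]c4 /r ltn_ord.
have rI u v : r u = r v -> u = v by move/val_inj/enum_rank_inj.
have nr u v : adj u v -> r u != r v.
  by move=> uv; apply: contraTneq uv => /rI->; rewrite adj_irrefl.
have a6 i j : i < 4 -> j < 4 -> K4_arc i j < 6.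
  by case: i => [|[|[|[|]]]] //; case: j => [|[|[|[|]]]].
apply: (@arc_coloring_colorable G 6 (fun v => inord (r v))
  (fun u v => inord (K4_arc (r u) (r v)))).
- move=> u v /nr; have := r4 u; have := r4 v; move: (r u) (r v) => i j j4 i4 ij.
  have [b1 b2] := (a6 i j i4 j4, a6 j i j4 i4).
  by split=> /(congr1 val); rewrite /= !inordK //; move: i j i4 j4 ij {b1 b2};
    do 2![case=> [|[|[|[|]]]] //].
- move=> u v w /nr + /nr; have := r4 u; have := r4 v; have := r4 w.
  move: (r u) (r v) (r w) => i j k k4 j4 i4 ij ik /(congr1 val).
  rewrite /= !inordK ?a6 //; move: i j k i4 j4 k4 ij ik.
  by do 3![case=> [|[|[|[|]]]] //].
- move=> u v w /nr + /nr + vw;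
    have : r v != r w by apply: contra_notN vw => /eqP/rI.
  have := r4 u; have := r4 v; have := r4 w.
  move: (r u) (r v) (r w) => i j k k4 j4 i4 jk ij ik /(congr1 val).
  rewrite /= !inordK ?a6 //; move: i j k i4 j4 k4 ij ik jk.
  by do 3![case=> [|[|[|[|]]]] //].
(* The two lists hold the colours found off the diagonal in column [r v] of the table. *)
- move=> v; exists (inord (nth 0 [:: 2; 3; 4; 5] (r v))).
  exists (inord (nth 0 [:: 1; 0; 4; 5] (r v))) => u /nr.
  have := r4 u; have := r4 v; move: (r u) (r v) => i j; rewrite !inE.
  by move: i j; do 2![case=> [|[|[|[|]]]] //] => _ _ _; rewrite eqxx ?orbT.
Qed.

(** * Graphs without theta subgraphs *)

(** [P j] lists the inner vertices of the [j]-th path from [u] to [v]. None may be empty, so a cycle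
    with a chord is not a theta in this sense. *)
Definition theta_free (G : sgraph) : Prop :=
  forall (u v : G) (P : nat -> seq G),
  (forall j, j < 3 -> [/\ P j != [::], path (@adj G) u (rcons (P j) v) &
                              uniq (u :: rcons (P j) v)]) ->
  (forall j l x, j < 3 -> l < 3 -> j != l -> x \in P j -> x \notin P l) ->
  False.

Lemma theta_free_seq (G : sgraph) (u v : G) (p q r : seq G) : theta_free G ->
  p != [::] -> q != [::] -> r != [::] ->
  path (@adj G) u (rcons p v) -> path (@adj G) u (rcons q v) ->
  path (@adj G) u (rcons r v) -> ~~ uniq (u :: v :: p ++ q ++ r).
Proof.
move=> tf p0 q0 r0 pp pq pr; apply/negP => us.
have [U1 [U2 U3]] : uniq (u :: rcons p v) /\ uniq (u :: rcons q v) /\ uniq (u :: rcons r v).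
  move: us; rewrite /= !cat_uniq !inE !mem_cat !mem_rcons !rcons_uniq !inE.
  rewrite !negb_or => /andP[/andP[-> /andP[-> /andP[-> ->]]]].
  by case/andP=> /andP[-> /andP[-> ->]] /and3P[-> _ /and3P[-> _ ->]].
have D1 x : x \in p -> x \notin q /\ x \notin r.
  move=> xp; move: us;
    rewrite /= !cat_uniq has_cat negb_or => /and3P[_ _ /and3P[_ /andP[h1 h2] _]].
  by split; apply/negP => h; [case/hasP: h1|case/hasP: h2]; exists x.
have D2 x : x \in q -> x \notin r.
  move=> xq; move: us;
    rewrite /= !cat_uniq => /and3P[_ _ /and3P[_ _ /and3P[_ h _]]].
  by apply/negP => h'; case/hasP: h; exists x.
apply: (tf u v (nth [::] [:: p; q; r])); first by case=> [|[|[|]]].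
have D1' x : x \in q -> x \notin p by move=> xq; apply/negP => /D1[];
  rewrite xq.
have D2' x : x \in r -> x \notin q by move=> xr; apply/negP => /D2; rewrite xr.
have D3' x : x \in r -> x \notin p by move=> xr; apply/negP => /D1[];
  rewrite xr.
by case=> [|[|[|]]] // [|[|[|]]] //= x _ _ _ => [/D1[]|/D1[]|/D1'|/D2|/D3'|/D2'].
Qed.

Lemma path_rev (G : sgraph) (x y : G) p :
  path (@adj G) x (rcons p y) = path (@adj G) y (rcons (rev p) x).
Proof.
have := rev_path (@adj G) x (rcons p y).
rewrite last_rcons belast_rcons rev_cons => ->.
by apply: eq_path => a b; rewrite adj_sym.
Qed.

Lemma rev_eq_nil (T : eqType) (s : seq T) : (rev s == [::]) = (s == [::]).
Proof. by rewrite -!size_eq0 size_rev. Qed.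

Lemma connect_leave (T : finType) (e : rel T) (A : pred T) x y :
  connect e x y -> A x -> ~~ A y -> exists a b, [/\ A a, ~~ A b & e a b].
Proof.
case/connectP=> p + ->; elim: p x => [|z p IH] x /=; first by move=> _ ->.
case/andP=> xz pz Ax; case Az : (A z); first exact: IH pz Az.
by move=> _; exists x, z; rewrite Az.
Qed.

(** Leave the cycle at [x] towards a vertex [v] off it and, inside the connected graph without [x],
    continue until the cycle is first met again, at [y]. If [x] and [y] are consecutive, this detour
    replaces the edge between them; otherwise it forms a theta with the two arcs of the cycle. *)
Lemma cycle_extend (G : sgraph) (s : seq G) (z : G) :
  k_connected 2 G -> theta_free G -> cycle (@adj G) s -> uniq s ->
  1 < size s -> z \notin s ->
  exists s', [/\ cycle (@adj G) s', uniq s' & size s < size s'].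
Proof.
move=> [cG conn] tf cs us ss zs.
have [x [v [xs vs xv]]] : exists x v, [/\ x \in s, v \notin s & adj x v].
  have [a as_] : exists a, a \in s by case: s ss {cs us zs} => // a s;
    exists a; rewrite mem_head.
  have := conn set0; rewrite cards0 => /(_ isT) c0.
  have := c0 a z; rewrite !inE => /(_ isT isT) H.
  have [b [c [bs cs' /and3P[_ _ bc]]]] := connect_leave (A := mem s) H as_ zs.
  by exists b, c.
have [i s' rs] := rot_to xs.
move: cs us ss; rewrite -(rot_cycle i) -(rot_uniq i) -(size_rot i s) rs => cs us ss.
have vs' : v \notin x :: s' by rewrite -rs mem_rot.
have mS y : (y \in ~: [set x]) = (y != x) by rewrite !inE.
have [y0 y0s] : exists y, y \in s'.
  by case: s' ss {rs cs us vs'} => // y s' _; exists y; rewrite mem_head.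
have xns : x \notin s' by move: us => /= /andP[].
have := conn [set x]; rewrite cards1 => /(_ isT) c1.
have := c1 v y0; rewrite !mS.
have -> : v != x by move: vs'; rewrite inE negb_or => /andP[].
have -> : y0 != x by apply: contraNneq xns => <-.
move=> /(_ isT isT)/connectP[q0 pq0 lq0].
have [q [pq uq lq]] : exists q, [/\ path [rel a b | [&& a \in ~: [set x],
    b \in ~: [set x] & adj a b]] v q, uniq (v :: q) & y0 = last v q].
  by case/shortenP: pq0 lq0 => q pq uq _ lq; exists q.
have xq : x \notin q.
  apply/negP => /splitPr e; case: e pq => q1 q2;
    rewrite cat_path /= => /and3P[_ + _].
  by rewrite /= !inE eqxx andbF.
have hq : has (mem s') q.
  apply/hasP; exists y0 => //; move: (mem_last v q);
    rewrite -lq inE => /orP[/eqP e|//].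
  by move: vs'; rewrite inE -e y0s orbT.
case: (split_find hq) pq uq xq {lq} => y q1 q2 ys nq1 pq uq xq.
have {}pq : path (@adj G) v (rcons q1 y).
  by move: pq; rewrite cat_path => /andP[+ _]; apply: sub_path => a b /and3P[].
pose W := v :: q1.
have pW : path (@adj G) x (rcons W y) by rewrite /= xv pq.
have WD a : a \in W -> a \notin x :: s'.
  rewrite /W !in_cons => /orP[/eqP->|aq]; first by rewrite -in_cons.
  rewrite negb_or; apply/andP; split.
    by apply: contraNneq xq => <-; rewrite mem_cat mem_rcons inE aq orbT.
  by apply: (hasPn nq1).
have uW : uniq W.
  move: uq; rewrite /W /= cat_uniq rcons_uniq !mem_cat mem_rcons !inE !negb_or.
  by case/andP=> /andP[/andP[_ ->] _] /andP[/andP[_ ->]].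
have W0 : W != [::] by [].
clearbody W; case/splitPr: ys cs us ss WD {vs' y0s xns hq nq1 rs} pW => l r cs us ss WD pW.
have U : uniq (W ++ x :: l ++ y :: r).
  by rewrite cat_uniq uW us andbT; apply/hasPn => a ar; apply: contraL ar;
    exact: WD.
have permU t : perm_eq (W ++ x :: l ++ y :: r) t -> uniq t by move/perm_uniq <-.
have sW : 0 < size W by rewrite lt0n size_eq0.
move: cs; rewrite /= rcons_cat cat_path /= => /and3P[pl ly pr].
have plr : path (@adj G) x (rcons l y) by rewrite rcons_path pl.
have [l0|l0] := eqVneq l [::].
  exists (x :: W ++ y :: r); split.
  - by rewrite /= rcons_cat rcons_cons -cat_rcons cat_path last_rcons pW.
  - by apply: permU; rewrite l0; apply/permP => a; rewrite /= !count_cat /=;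
      clear; lia.
  - by rewrite l0 /= size_cat /= addnS !ltnS -[X in X < _]add0n ltn_add2r.
have [r0|r0] := eqVneq r [::].
  exists (x :: l ++ y :: rev W); split.
  - rewrite /= rcons_cat rcons_cons -cat_rcons cat_path last_rcons plr.
    by rewrite -path_rev.
  - by apply: permU; rewrite r0; apply/permP => a;
      rewrite /= !count_cat /= !count_cat /= count_rev; clear; lia.
  - by rewrite r0 /= !size_cat /= size_rev !ltnS ltn_add2l ltnS.
have rr0 : rev r != [::] by rewrite rev_eq_nil.
have prr : path (@adj G) x (rcons (rev r) y) by rewrite -path_rev.
case/negP: (theta_free_seq tf W0 l0 rr0 pW plr prr); apply: permU.
by apply/permP => a; rewrite /= !count_cat /= !count_cat /= count_rev; clear;
  lia.
Qed.

Lemma hamiltonian (G : sgraph) (x y : G) :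
  k_connected 2 G -> theta_free G -> adj x y ->
  exists s : seq G, [/\ cycle (@adj G) s, uniq s & forall z, z \in s].
Proof.
move=> kc tf xy.
have arith N i j d : N - i < d.+1 -> i < j -> j <= N -> N - j < d by lia.
suff H d (s : seq G) : #|G| - size s < d -> cycle (@adj G) s -> uniq s -> 1 < size s ->
    exists s : seq G, [/\ cycle (@adj G) s, uniq s & forall z, z \in s].
  (* An edge traversed back and forth serves as the initial cycle, of length two. *)
  apply: (H _ [:: x; y] (ltnSn _)) => //=; first by rewrite xy adj_sym xy.
  by rewrite inE andbT; apply: contraTneq xy => ->; rewrite adj_irrefl.
elim: d s => // d IH s lt_d cs us ss.
have [/forallP als|] := boolP [forall z, z \in s]; first by exists s.
rewrite negb_forall => /existsP[z zs].
have [s' [cs' us' ss']] := cycle_extend kc tf cs us ss zs.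
apply: (IH s') => //; last exact: ltn_trans ss ss'.
have := uniq_leq_size us' (fun z _ => mem_enum G z).
by rewrite -cardE; exact: arith lt_d ss'.
Qed.

(** If [l1] had a vertex, three paths would join [x] to [z]: along [l1]; over the chord to [y] and
    back through [l2]; back through [l4] to [w] and over the other chord. *)
Lemma crossing_adjacent (G : sgraph) (x y z w : G) (l1 l2 l3 l4 : seq G) :
  theta_free G -> let s := x :: l1 ++ z :: l2 ++ y :: l3 ++ w :: l4 in
  cycle (@adj G) s -> uniq s -> adj x y -> adj z w -> l1 = [::].
Proof.
move=> tf s cs us xy zw; apply/eqP; apply: contraT => l10.
move: cs; rewrite /s /= !rcons_cat /= !rcons_cat /= !rcons_cat /=.
rewrite !cat_path /= !cat_path /= !cat_path /= => /and3P[p1 h1 /and3P[p2 h2 /and3P[p3 h3 p4]]].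
have q1 : path (@adj G) x (rcons l1 z) by rewrite rcons_path p1.
have q2 : path (@adj G) x (rcons (y :: rev l2) z).
  by rewrite /= xy -path_rev rcons_path p2.
have q3 : path (@adj G) x (rcons (rcons (rev l4) w) z).
  by rewrite rcons_path -path_rev p4 last_rcons adj_sym.
have n3 : rcons (rev l4) w != [::] by case: (rev l4).
case/negP: (theta_free_seq tf l10 (isT : y :: rev l2 != [::]) n3 q1 q2 q3).
rewrite -(perm_uniq (s1 := x :: l1 ++ z :: l2 ++ y :: w :: l4)).
  move: us; rewrite /s; apply: subseq_uniq.
  rewrite /= eqxx; apply: cat_subseq (subseq_refl _) _.
  rewrite /= eqxx; apply: cat_subseq (subseq_refl _) _.
  by rewrite /= eqxx suffix_subseq.
by apply/permP => a;
  rewrite /= !count_cat /= !count_cat /= -cats1 !count_cat !count_rev /=;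
    clear; lia.
Qed.

Lemma nth_split (T : Type) (x0 : T) (s : seq T) i : i < size s ->
  s = take i s ++ nth x0 s i :: drop i.+1 s.
Proof. by move=> si; rewrite -drop_nth // cat_take_drop. Qed.

(** Rotating the cycle lets [crossing_adjacent] apply to each of the four gaps between the ends of
    the crossing chords; all gaps are empty. *)
Lemma crossing_size (G : sgraph) (x0 : G) (s : seq G) (i j k l : nat) :
  theta_free G -> cycle (@adj G) s -> uniq s -> i < j < k -> k < l < size s ->
  adj (nth x0 s i) (nth x0 s k) -> adj (nth x0 s j) (nth x0 s l) ->
  size s = 4.
Proof.
move=> tf cs us ijk kls; set x := nth x0 s i; set z := nth x0 s j.
set y := nth x0 s k; set w := nth x0 s l => xy zw.
have [l0 [l1 [l2 [l3 [l4 sE]]]]] : exists l0 l1 l2 l3 l4,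
    s = l0 ++ x :: l1 ++ z :: l2 ++ y :: l3 ++ w :: l4.
  have [ij jk] := andP ijk; have [kl ls] := andP kls.
  have s1 : size (take l s) = l by rewrite size_takel // ltnW.
  have s2 : size (take k (take l s)) = k by rewrite size_takel // s1 ltnW.
  have s3 : size (take j (take k (take l s))) = j by rewrite size_takel // s2 ltnW.
  have e1 := nth_split x0 ls.
  have := @nth_split _ x0 (take l s) k; rewrite s1 => /(_ kl).
  have := @nth_split _ x0 (take k (take l s)) j; rewrite s2 => /(_ jk).
  have := @nth_split _ x0 (take j (take k (take l s))) i; rewrite s3 => /(_ ij).
  move: e1; have jl := ltn_trans jk kl; have ik := ltn_trans ij jk.
  rewrite !nth_take ?(ltn_trans ij jl) //.
  move=> e1 e4 e3 e2; do 5![eexists].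
  rewrite [LHS]e1 [X in X ++ _]e2 [X in (X ++ _) ++ _]e3 [X in ((X ++ _) ++ _) ++ _]e4.
  by rewrite -!catA /=; reflexivity.
pose s' := x :: l1 ++ z :: l2 ++ y :: l3 ++ w :: (l4 ++ l0).
have rs : s' = rot (size l0) s.
  by rewrite sE rot_size_cat /s' /= -!catA /= -?catA /= -?catA.
have cs' : cycle (@adj G) s' by rewrite rs rot_cycle.
have us' : uniq s' by rewrite rs rot_uniq.
have turn (a b c d : G) (p1 p2 p3 p4 : seq G) :
    let s1 := a :: p1 ++ b :: p2 ++ c :: p3 ++ d :: p4 in
    let s2 := b :: p2 ++ c :: p3 ++ d :: p4 ++ a :: p1 in
    cycle (@adj G) s1 -> uniq s1 -> cycle (@adj G) s2 /\ uniq s2.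
  move=> s1 s2; have -> : s2 = rot (size (a :: p1)) s1.
    by rewrite /s1 -cat_cons rot_size_cat /s2 /= -!catA /= -?catA /= -?catA.
  by rewrite rot_cycle rot_uniq.
have yx : adj y x by rewrite adj_sym.
have wz : adj w z by rewrite adj_sym.
have H1 := crossing_adjacent tf cs' us' xy zw.
have [c2 u2] := turn _ _ _ _ _ _ _ _ cs' us'.
have H2 := crossing_adjacent tf c2 u2 zw yx.
have [c3 u3] := turn _ _ _ _ _ _ _ _ c2 u2.
have H3 := crossing_adjacent tf c3 u3 yx wz.
have [c4 u4] := turn _ _ _ _ _ _ _ _ c3 u3.
have H4 := crossing_adjacent tf c4 u4 wz xy.
by rewrite -(size_rot (size l0) s) -rs /s' H1 H2 H3 H4.
Qed.

Lemma theta_free_colorable (G : sgraph) :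
  k_connected 2 G -> theta_free G -> max_degree G = 3 -> ks_colorable G 2 6.
Proof.
move=> kc tf md.
have deg (v : G) : #|neighbours v| <= 3.
  by rewrite -md /max_degree (bigD1 v) //= leq_maxl.
have [x [y xy]] : exists x y : G, adj x y.
  have [/forallP/(_ _)/forallP H|] := boolP [forall x : G, forall y : G, ~~ adj x y].
    suff : max_degree G <= 0 by rewrite md.
    apply/bigmax_leqP => v _; rewrite leqn0 cards_eq0; apply/eqP/setP => u.
    by rewrite !inE (negPf (H v u)).
  rewrite negb_forall => /existsP[x]; rewrite negb_forall => /existsP[y].
  by rewrite negbK => xy; exists x, y.
have [s [cs us als]] := hamiltonian kc tf xy.
have sG : size s = #|G| by rewrite -(card_uniqP us); apply: eq_card => z;
  rewrite als.
have [s4|s4] := eqVneq (size s) 4.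
  by apply: four_vertices_colorable; rewrite -sG.
apply: (@hamiltonian_colorable G x s) => //.
  by have [h _] := kc; rewrite sG.
move=> i j k l ijk kls ik; apply/negP => jl.
by have /eqP := crossing_size tf cs us ijk kls ik jl; rewrite (negPf s4).
Qed.

(** * Tightness: the four-cycle with one chord *)

Lemma colorable_arc_coloring (G : sgraph) (s k : nat) : ks_colorable G s k ->
  exists (C : G -> 'I_k) (a : G -> G -> 'I_k),
  [/\ forall u v, adj u v -> [/\ C u <> C v, C u <> a u v & C u <> a v u],
      forall u v w, adj u v -> adj u w -> a u v <> a w u &
      forall u v w, adj u v -> adj u w -> v <> w -> a u v <> a u w].
Proof.
move=> [c [vi _]].
(* For non-adjacent pairs the value [c (inl u)] is only a default. *)
pose a u v := if [pick i : incidence G | ((val i).1 == u) && (other_end i == v)] is Some i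
  then c (inr i) else c (inl u).
have aE u v : adj u v -> exists i : incidence G,
    [/\ a u v = c (inr i), (val i).1 = u & other_end i = v].
  move=> uv; have [i [iv io]] := mk_incidence uv; rewrite /a;
    case: pickP => [j /andP[/eqP h1 /eqP h2]|].
    by exists j.
  by move/(_ i); rewrite iv io !eqxx.
have rev i j : (val i).1 = other_end j -> other_end i = (val j).1 ->
    subdiv3_adj (inr i) (inr j).
  move=> h1 h2; have [ei ni] := other_endP i; have [ej nj] := other_endP j.
  by rewrite /= ei ej h1 h2 finset.setUC eqxx /=; apply/eqP.
exists (fun v => c (inl v)), a; split.
- move=> u v uv; have [i [-> it ih]] := aE u v uv.
  have vu : adj v u by rewrite adj_sym.
  have [j [-> jt jh]] := aE v u vu.
  have ij : subdiv3_adj (inr i) (inr j) by apply: rev; rewrite ?it ?ih ?jt ?jh.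
  split; apply: vi => //.
  + by case=> e; move: uv; rewrite e adj_irrefl.
  + by exists [:: inr i; inr j; inl v]; split=> //; apply/and4P; split=> //=;
      apply/eqP.
  + by exists [:: inr i]; split=> //=; rewrite it eqxx.
  + by exists [:: inr i; inr j]; split=> //; apply/and3P; split=> //=;
      apply/eqP.
- move=> u v w uv uw; have [i [-> it ih]] := aE u v uv;
    have [j [_ jt jh]] := aE u w uw.
  have wu : adj w u by rewrite adj_sym.
  have [l [-> lt lh]] := aE w u wu.
  apply: vi; first by case=> e; move: uw; rewrite -it -lt e adj_irrefl.
  exists [:: inl u; inr j; inr l]; split=> //; apply/and4P; split=> //=;
    try exact/eqP.
  by apply: rev; rewrite ?jt ?jh ?lt ?lh.
- move=> u v w uv uw vw; have [i [-> it ih]] := aE u v uv;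
    have [j [-> jt jh]] := aE u w uw.
  apply: vi; first by case=> e; apply: vw; rewrite -ih -jh e.
  by exists [:: inl u; inr j]; split=> //; apply/and3P; split=> //=; apply/eqP.
Qed.

(** The odd vertices 1 and 3 form the only non-adjacent pair; 0 and 2 are the ends of the chord. *)
Definition diamond_adj (i j : 'I_4) : bool := (i != j) && ~~ (odd i && odd j).

Lemma diamond_adj_sym : symmetric diamond_adj.
Proof. by move=> i j;
  rewrite /diamond_adj eq_sym andbC (andbC (odd i)) andbC. Qed.

Lemma diamond_adj_irrefl : irreflexive diamond_adj.
Proof. by move=> i; rewrite /diamond_adj eqxx. Qed.

Definition diamond : sgraph := SGraph diamond_adj_sym diamond_adj_irrefl.

Lemma uniq_ord_size (k : nat) (s : seq 'I_k) : uniq s -> size s <= k.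
Proof. by move/card_uniqP <-; rewrite -[X in _ <= X]card_ord max_card. Qed.

(** With at most five colours, vertex 0 and its outgoing arcs use four, so all arcs into 0 share one
    colour; likewise at 2. These two colours and those of 0 and 2 are distinct and all avoided by 1
    and 3, which therefore have equal colours. This colour, that of the arcs into 0, and the four at
    0 are then six distinct ones. *)
Lemma diamond_colors (s k : nat) : ks_colorable diamond s k -> 5 < k.
Proof.
case/colorable_arc_coloring => C [a [hC hio hoo]].
rewrite ltnNge; apply/negP => k5.
have fifth c o1 o2 o3 (i i' : 'I_k) : uniq [:: c; o1; o2; o3] ->
    i \notin [:: c; o1; o2; o3] -> i' \notin [:: c; o1; o2; o3] -> i = i'.
  move=> u h h'; apply/eqP; apply: contraT => ii'.
  have := @uniq_ord_size k [:: i, i' & [:: c; o1; o2; o3]].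
  rewrite cons_uniq in_cons negb_or ii' h cons_uniq h' u => /(_ isT) /=.
  by lia.
pose v (n : nat) : diamond := @inord 3 n.
have ad n m : n < 4 -> m < 4 -> n != m -> ~~ (odd n && odd m) -> adj (v n) (v m).
  by move=> n4 m4 nm o; rewrite /= /diamond_adj -val_eqE /= !inordK // nm.
have vn n m : n < 4 -> m < 4 -> n != m -> v n <> v m.
  by move=> n4 m4 nm /(congr1 val); rewrite /= !inordK // => /eqP;
    rewrite (negPf nm).
have F0 n m : n < 4 -> m < 4 -> n != m -> ~~ (odd n && odd m) ->
    [/\ C (v n) != C (v m), C (v n) != a (v n) (v m) & C (v n) != a (v m) (v n)].
  by move=> h1 h2 h3 h4; have [g1 g2 g3] := hC _ _ (ad n m h1 h2 h3 h4); split;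
    apply/eqP.
have F1 n m l : n < 4 -> m < 4 -> l < 4 -> n != m -> n != l ->
    ~~ (odd n && odd m) -> ~~ (odd n && odd l) -> a (v n) (v m) != a (v l) (v n).
  by move=> *; apply/eqP/hio; exact: ad.
have F2 n m l : n < 4 -> m < 4 -> l < 4 -> n != m -> n != l -> m != l ->
    ~~ (odd n && odd m) -> ~~ (odd n && odd l) -> a (v n) (v m) != a (v n) (v l).
  by move=> *; apply/eqP/hoo; [exact: ad|exact: ad|exact: vn].
have star n n' : n < 4 -> n' < 4 -> n != n' -> ~~ odd n -> ~~ odd n' ->
    uniq [:: C (v n); a (v n) (v 1); a (v n) (v n'); a (v n) (v 3)] /\
    forall m, m < 4 -> m != n ->
      a (v m) (v n) \notin [:: C (v n); a (v n) (v 1); a (v n) (v n'); a (v n) (v 3)].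
  move=> n4 n'4 nn' on on'.
  have n1 : n != 1 by apply: contraNneq on => ->.
  have n3 : n != 3 by apply: contraNneq on => ->.
  have n'1 : 1 != n' by apply: contraNneq on' => <-.
  have n'3 : n' != 3 by apply: contraNneq on' => ->.
  have o m : ~~ (odd n && odd m) by rewrite (negPf on).
  split=> [|m m4 mn].
    rewrite /= !inE !negb_or !F2 //.
    have [_ -> _] := F0 n 1 n4 isT n1 (o 1);
      have [_ -> _] := F0 n n' n4 n'4 nn' (o n').
    by have [_ -> _] := F0 n 3 n4 isT n3 (o 3).
  have nm : n != m by rewrite eq_sym.
  have [_ _ h] := F0 n m n4 m4 nm (o m).
  by rewrite !inE !negb_or ![a (v m) _ == _]eq_sym h !F1.
have [u0 i0] := star 0 2 isT isT isT isT isT;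
  have [u2 i2] := star 2 0 isT isT isT isT isT.
have e1 : a (v 1) (v 0) = a (v 2) (v 0) by apply: fifth u0 _ _; exact: i0.
have e3 : a (v 3) (v 0) = a (v 2) (v 0) by apply: fifth u0 _ _; exact: i0.
have f1 : a (v 1) (v 2) = a (v 0) (v 2) by apply: fifth u2 _ _; exact: i2.
have f3 : a (v 3) (v 2) = a (v 0) (v 2) by apply: fifth u2 _ _; exact: i2.
have [c02 c0b c0a] := F0 0 2 isT isT isT isT;
  have [_ c2a c2b] := F0 2 0 isT isT isT isT.
have [c10 c1a c1o] := F0 1 0 isT isT isT isT;
  have [c12 c1b _] := F0 1 2 isT isT isT isT.
have [c30 c3a c3o] := F0 3 0 isT isT isT isT;
  have [c32 c3b _] := F0 3 2 isT isT isT isT.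
rewrite e1 in c1a; rewrite e3 in c3a; rewrite f1 in c1b; rewrite f3 in c3b.
have ab := F1 2 0 0 isT isT isT isT isT isT isT.
have c13 : C (v 1) = C (v 3).
  apply: (fifth (C (v 0)) (C (v 2)) (a (v 2) (v 0)) (a (v 0) (v 2))).
  - by rewrite /= !inE !negb_or c02 c0a c0b c2a c2b ab.
  - by rewrite !inE !negb_or c10 c12 c1a c1b.
  - by rewrite !inE !negb_or c30 c32 c3a c3b.
have h2 := i0 2 isT isT.
have := @uniq_ord_size k [:: C (v 1), a (v 2) (v 0) & [:: C (v 0); a (v 0) (v 1); a (v 0) (v 2); a (v 0) (v 3)]].
rewrite cons_uniq (cons_uniq (a (v 2) (v 0))) h2 u0 andbT.
by rewrite !inE !negb_or c10 c1a c1o c1b c13 c3o => /(_ isT) /=; clear -k5; lia.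
Qed.

(** Vertices 0 and 2 are adjacent to all others, and at most one of them is removed. *)
Lemma diamond_2connected : k_connected 2 diamond.
Proof.
split; first by rewrite card_ord.
move=> X X2 x y; rewrite !inE => xX yX.
have [->|xy] := eqVneq x y; first exact: connect0.
case: (boolP (diamond_adj x y)) => [axy|nxy].
  by apply: connect1; rewrite /= !inE xX yX.
have [ox oy] : odd x /\ odd y.
  by move: nxy; rewrite /diamond_adj xy /= negbK => /andP[].
have [z zX oz] : exists2 z : 'I_4, z \notin X & ~~ odd z.
  have [h0|h0] := boolP ((inord 0 : 'I_4) \in X); last by exists (inord 0);
    rewrite ?inordK.
  exists (inord 2); rewrite ?inordK //; apply/negP => h2; move: X2;
    rewrite ltnNge => /negP[].
  have -> : 2 = #|[set inord 0; inord 2 : 'I_4]|.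
    by rewrite cards2 -val_eqE /= !inordK.
  by apply: subset_leq_card; apply/subsetP => w; rewrite !inE => /orP[]/eqP->.
have zx : z != x by apply: contraNneq oz => ->.
have zy : z != y by apply: contraNneq oz => ->.
apply: (@connect_trans _ _ z); apply: connect1;
  rewrite /= !inE ?xX ?yX zX /diamond_adj.
  by rewrite eq_sym zx (negPf oz) andbF.
by rewrite zy (negPf oz).
Qed.

Lemma diamond_max_degree : max_degree diamond = 3.
Proof.
have c3 (v : 'I_4) : #|~: [set v]| = 3 by rewrite cardsC1 card_ord.
apply/eqP; rewrite eqn_leq; apply/andP; split.
  apply/bigmax_leqP => v _; rewrite -(c3 v); apply: subset_leq_card.
  by apply/subsetP => u; rewrite !inE /= /diamond_adj eq_sym => /andP[].
rewrite -(c3 ord0) /max_degree (bigD1 (ord0 : diamond)) //= leq_max; apply/orP;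
  left.
apply: subset_leq_card; apply/subsetP => u; rewrite !inE /= /diamond_adj eq_sym.
by move=> ->.
Qed.

From mathcomp Require Import all_order all_algebra.
From mathcomp Require Import all_classical all_reals all_analysis.
From mathcomp Require Import ring lra.

Section PlaneDrawings.
Import Order.TTheory GRing.Theory Num.Theory.
Import numFieldNormedType.Exports.
Local Open Scope ring_scope.
Local Open Scope classical_set_scope.

(** * Non-planarity of K33 *)

(** Each quadrant contains exactly one of its bounding half-axes, so that negation shifts the index
    by 2; the zero vector falls by default into quadrant 3. *)
Definition quadrant (R : realFieldType) (v : R * R) : nat :=
  if (0 < v.1) && (0 <= v.2) then 0 else if (v.1 <= 0) && (0 < v.2) then 1
  else if (v.1 < 0) && (v.2 <= 0) then 2 else 3.

(** Between opposite quadrants the direction is ambiguous; the value 2 is a convention compatible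
    with [turn_mod]. *)
Definition turn (p q : nat) : int :=
  if p == q then 0 else if q == (p.+1 %% 4)%N then 1
  else if p == (q.+1 %% 4)%N then -1 else 2.

(* Winding of the point sequence [a :: s] around [x], in quarter turns. *)
Fixpoint winding (R : realFieldType) (x a : R * R) (s : seq (R * R)) : int :=
  if s is b :: s' then
    turn (quadrant (a - x)) (quadrant (b - x)) + winding x b s'
  else 0.

Definition nearby (R : realFieldType) (e : R) (v w : R * R) :=
  (`|v.1 - w.1| < e) && (`|v.2 - w.2| < e).

(** Twice the scale of [nearby]: if each point moves by one step, some coordinate of the difference
    still keeps its sign. *)
Definition far (R : realFieldType) (e : R) (v w : R * R) :=
  (e + e <= `|v.1 - w.1|) || (e + e <= `|v.2 - w.2|).

Lemma quadrant_lt4 (R : realFieldType) (v : R * R) : (quadrant v < 4)%N.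
Proof. by rewrite /quadrant; do ![case: ifP => // _]. Qed.

Lemma quadrantN (R : realFieldType) (v : R * R) :
  (v.1 != 0) || (v.2 != 0) -> quadrant (- v) = ((quadrant v + 2) %% 4)%N.
Proof.
case: v => x y; rewrite /quadrant /= !oppr_gt0 !oppr_ge0 !oppr_le0 !oppr_lt0.
by case: (ltgtP x 0) => ?; case: (ltgtP y 0).
Qed.

Lemma turnD2 p q : (p < 4)%N -> (q < 4)%N ->
  turn ((p + 2) %% 4) ((q + 2) %% 4) = turn p q.
Proof. by case: p => [|[|[|[|]]]] //; case: q => [|[|[|[|]]]]. Qed.

Lemma turn_mod p q : (p < 4)%N -> (q < 4)%N ->
  exists k : int, turn p q = q%:Z - p%:Z + 4 * k.
Proof.
move=> p4 q4; have : [|| turn p q == q%:Z - p%:Z, turn p q == q%:Z - p%:Z + 4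
    | turn p q == q%:Z - p%:Z - 4].
  by case: p p4 => [|[|[|[|]]]] //; case: q q4 => [|[|[|[|]]]].
by case/or3P => /eqP->; [exists 0 | exists 1 | exists (-1)]; lia.
Qed.

Lemma winding_mod (R : realFieldType) (x a : R * R) s : exists k : int,
  winding x a s =
  (quadrant (last a s - x))%:Z - (quadrant (a - x))%:Z + 4 * k.
Proof.
elim: s a => [|b s IH] a /=; first by exists 0; lia.
have [k ->] := IH b.
have [l ->] := turn_mod (quadrant_lt4 (a - x)) (quadrant_lt4 (b - x)).
by exists (l + k); lia.
Qed.

Lemma quadrant_right (R : realFieldType) (v : R * R) : 0 < v.1 ->
  (quadrant v == 3%N) || (quadrant v == 0%N).
Proof. by rewrite /quadrant; case: (ltgtP v.1 0); case: (ltgtP v.2 0). Qed.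

Lemma quadrant_left (R : realFieldType) (v : R * R) : v.1 < 0 ->
  (quadrant v == 1%N) || (quadrant v == 2%N).
Proof. by rewrite /quadrant; case: (ltgtP v.1 0); case: (ltgtP v.2 0). Qed.

Lemma quadrant_up (R : realFieldType) (v : R * R) : 0 < v.2 ->
  (quadrant v == 0%N) || (quadrant v == 1%N).
Proof. by rewrite /quadrant; case: (ltgtP v.1 0); case: (ltgtP v.2 0). Qed.

Lemma quadrant_down (R : realFieldType) (v : R * R) : v.2 < 0 ->
  (quadrant v == 2%N) || (quadrant v == 3%N).
Proof. by rewrite /quadrant; case: (ltgtP v.1 0); case: (ltgtP v.2 0). Qed.

(* The four differences lie in a common open half-plane bounded by an axis,
   where the quadrant is a well-defined angle. *)
Lemma turn_square (R : realFieldType) (e : R) (a a' c c' : R * R) :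
  nearby e a a' -> nearby e c c' -> far e a c ->
  turn (quadrant (a - c)) (quadrant (a' - c)) +
  turn (quadrant (a' - c)) (quadrant (a' - c')) =
  turn (quadrant (a - c)) (quadrant (a - c')) +
  turn (quadrant (a - c')) (quadrant (a' - c')).
Proof.
case: a a' c c' => [a1 a2] [b1 b2] [c1 c2] [d1 d2].
rewrite /nearby /far /= !ltr_norml.
move=> /andP[/andP[H1 H2] /andP[H3 H4]] /andP[/andP[H5 H6] /andP[H7 H8]] H.
set q1 := quadrant _; set q2 := quadrant _; set q4 := quadrant _;
  set q3 := quadrant _.
have Q : [|| all (fun q => (q == 3%N) || (q == 0%N)) [:: q1; q2; q3; q4],
  all (fun q => (q == 1%N) || (q == 2%N)) [:: q1; q2; q3; q4],
  all (fun q => (q == 0%N) || (q == 1%N)) [:: q1; q2; q3; q4] |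
  all (fun q => (q == 2%N) || (q == 3%N)) [:: q1; q2; q3; q4]].
  case/orP: H; rewrite ler_normr => /orP[H|H]; apply/or4P.
  - by apply: Or41; rewrite /= !quadrant_right //=; lra.
  - by apply: Or42; rewrite /= !quadrant_left //=; lra.
  - by apply: Or43; rewrite /= !quadrant_up //=; lra.
  - by apply: Or44; rewrite /= !quadrant_down //=; lra.
move: Q; rewrite /= !andbT.
by case/or4P => /and4P[] /orP[]/eqP-> /orP[]/eqP-> /orP[]/eqP-> /orP[]/eqP->.
Qed.

Lemma turn_opp (R : realFieldType) (e : R) (a b x : R * R) :
  0 < e -> far e x a -> far e x b ->
  turn (quadrant (a - x)) (quadrant (b - x)) =
  turn (quadrant (x - a)) (quadrant (x - b)).
Proof.
have nz (v : R * R) : 0 < e -> far e x v -> ((x - v).1 != 0) || ((x - v).2 != 0).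
  move=> e0; rewrite /far; case: v x => [v1 v2] [x1 x2] /= H.
  by rewrite -!normr_gt0; case/orP: H => H; apply/orP; [left|right]; lra.
move=> e0 ha hb; rewrite -(opprB x a) -(opprB x b) !quadrantN ?nz //.
by rewrite turnD2 ?quadrant_lt4.
Qed.

Lemma winding_strip (R : realFieldType) (e : R) (a c c' : R * R) s : 0 < e ->
  path (nearby e) a s -> nearby e c c' ->
  (forall v, v \in a :: s -> far e v c /\ far e v c') ->
  winding c a s + turn (quadrant (c - last a s)) (quadrant (c' - last a s)) =
  turn (quadrant (c - a)) (quadrant (c' - a)) + winding c' a s.
Proof.
move=> e0; elim: s a => [|b s IH] a /=; first by rewrite addr0 add0r.
case/andP=> ab bs cc H; have IHb := IH b bs cc.
have [ac ac'] := H a (mem_head _ _).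
have [bc bc'] : far e b c /\ far e b c' by apply: H; rewrite !inE eqxx orbT.
rewrite -addrA IHb; last by move=> v vs; apply: H; rewrite inE vs orbT.
rewrite (turn_opp e0 bc bc') (turn_opp e0 ac ac') !addrA.
by rewrite (turn_square ab cc ac).
Qed.

(** Discrete homotopy: the difference of a point of the first sequence and one of the second never
    gets small, so its total rotation over the grid of pairs is the same along both boundary routes.
    Each grid square commutes by [turn_square]. *)
Lemma winding_grid (R : realFieldType) (e : R) (a c : R * R) s t : 0 < e ->
  path (nearby e) a s -> path (nearby e) c t ->
  (forall v w, v \in a :: s -> w \in c :: t -> far e v w) ->
  winding c a s + winding (last a s) c t =
  winding a c t + winding (last c t) a s.
Proof.
move=> e0 ps; elim: t c => [|d t IH] c /=; first by rewrite addr0 add0r.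
case/andP=> cd dt H; rewrite addrA (@winding_strip _ e) //; last first.
  by move=> v vs; split; apply: H => //; rewrite !inE eqxx ?orbT.
rewrite -addrA IH ?addrA // => v w vs wt; apply: H => //.
by rewrite inE wt orbT.
Qed.

(* Each integer [u k i j], [v l i j] occurs in exactly two of the eighteen
   relations, and the remaining terms add up to an odd number. *)
Lemma K33_parity (u v : nat -> nat -> nat -> int) (a b g d : nat -> nat -> int)
    (ka kb kg : nat -> nat -> int) :
  (forall i k, (i < k < 3)%N -> a i k = a k i + 2 + 4 * ka i k) ->
  (forall j l, (j < l < 3)%N -> b j l = b l j + 2 + 4 * kb j l) ->
  (forall i j, (i < 3)%N -> (j < 3)%N -> g i j = d i j + 2 + 4 * kg i j) ->
  (forall i j k l, (i < 3)%N -> (j < 3)%N -> (k < 3)%N -> (l < 3)%N ->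
     i != k -> j != l ->
     (g k j - a k i + 4 * u k i j) + (b j l - d k j + 4 * v j k l) =
     (g i l - a i k + 4 * u i k l) + (b l j - d i l + 4 * v l i j)) ->
  False.
Proof.
move=> Ha Hb Hg E.
(* The relations for the two perfect matchings of the 4-cycle on [A i], [A k], [B j], [B l] are
   added and divided by 4; the [kb] terms cancel. Each of the nine resulting equations contributes
   one 1. *)
have E1 i k j l : (i < k < 3)%N -> (j < l < 3)%N ->
   1 + kg k j + kg k l - kg i l - kg i j + 2 * ka i k +
   (u k i j + v j k l - u i k l - v l i j) +
   (u k i l + v l k j - u i k j - v j i l) = 0.
  move=> ik jl; have := Ha i k ik; have := Hb j l jl.
  have i3 : (i < 3)%N by lia.
  have j3 : (j < 3)%N by lia.
  have [k3 l3] : (k < 3)%N /\ (l < 3)%N by lia.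
  have nik : i != k by lia.
  have njl : j != l by lia.
  have nlj : l != j by lia.
  have := E i j k l i3 j3 k3 l3 nik njl; have := E i l k j i3 l3 k3 j3 nik nlj.
  have := Hg i j i3 j3; have := Hg i l i3 l3; have := Hg k j k3 j3;
    have := Hg k l k3 l3.
  by clear; lia.
have := E1 0%N 1%N 0%N 1%N isT isT; have := E1 0%N 1%N 0%N 2%N isT isT;
  have := E1 0%N 1%N 1%N 2%N isT isT.
have := E1 0%N 2%N 0%N 1%N isT isT; have := E1 0%N 2%N 0%N 2%N isT isT;
  have := E1 0%N 2%N 1%N 2%N isT isT.
have := E1 1%N 2%N 0%N 1%N isT isT; have := E1 1%N 2%N 0%N 2%N isT isT;
  have := E1 1%N 2%N 1%N 2%N isT isT.
by clear; lia.
Qed.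

Lemma nearbyE (R : realType) (e : R) (v w : R * R) :
  nearby e v w <-> ball v e w.
Proof. by rewrite /nearby; split=> [/andP//|[h1 h2]]; apply/andP. Qed.

Lemma nearby_sym (R : realType) (e : R) : symmetric (@nearby R e).
Proof. by move=> v w; rewrite /nearby distrC (distrC v.2). Qed.

(** The points reachable from [x] by such sequences form a nonempty subset that is both open and
    closed in [E]. *)
Lemma connected_chain (R : realType) (E : set (R * R)) (e : R) (x y : R * R) :
  connected E -> 0 < e -> E x -> E y ->
  exists2 s, path (nearby e) x s & last x s = y /\ forall v, v \in x :: s -> E v.
Proof.
move=> cE e0 Ex Ey.
pose B := [set z | exists2 s, path (nearby e) x s &
                    last x s = z /\ forall v, v \in x :: s -> E v].
suff : B = E by move=> BE; have : B y by rewrite BE.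
have step z w : B z -> E w -> nearby e z w -> B w.
  move=> [s ps [ls Es]] Ew zw; exists (rcons s w).
    by rewrite rcons_path ps ls.
  rewrite last_rcons; split=> // v; rewrite -rcons_cons mem_rcons inE.
  by case/orP=> [/eqP->//|/Es].
have BE z : B z -> E z by move=> [s _ [<- H]]; apply: H; exact: mem_last.
have Bx : B x by exists [::] => //; split=> // v; rewrite inE => /eqP->.
apply: cE; first by exists x.
- exists (\bigcup_(w in B) ball w e); first by apply: bigcup_open => w _;
    exact: ball_open.
  apply/seteqP; split=> [z Bz|z [Ez [w Bw /nearbyE wz]]];
    last exact: step Bw _ _.
  by split; [exact: BE|exists z => //; exact: ballxx].
- exists (~` \bigcup_(w in E `\` B) ball w e).
    by apply/open_closedC/bigcup_open => w _; exact: ball_open.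
  apply/seteqP; split=> z.
    move=> Bz; split; first exact: BE.
    move=> [w [Ew nBw] /nearbyE wz]; apply: nBw; apply: step Bz Ew _.
    by rewrite nearby_sym.
  move=> [Ez nz]; apply: contrapT => nBz; apply: nz.
  by exists z => //; exact: ballxx.
Qed.

(** The distance attains a positive minimum on [K] times [L]; as [far] compares with [e + e], half
    of it serves. *)
Lemma compact_far (R : realType) (K L : set (R * R)) :
  compact K -> compact L -> K `&` L = set0 ->
  exists2 e : R, 0 < e & forall v w, K v -> L w -> far e v w.
Proof.
move=> cK cL KL.
have [KL0|/set0P[p0 p0P]] := eqVneq (K `*` L) set0.
  exists 1 => // v w Kv Lw; have : (K `*` L) (v, w) by [].
  by rewrite KL0.
have cont : {within K `*` L, continuous (fun p : (R * R) * (R * R) => `|p.1 - p.2|)}.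
  apply: continuous_subspaceT => p; apply: cvg_norm.
  by apply: cvgB; [exact: cvg_fst|exact: cvg_snd].
have [[v0 w0] /set_mem[/= Kv0 Lw0] H] :=
  compact_EVT_min (ex_intro _ p0 p0P) (compact_setX cK cL) cont.
have n0 : 0 < `|v0 - w0|.
  rewrite normr_gt0 subr_eq0; apply/eqP => vw.
  have : (K `&` L) v0 by split=> //; rewrite vw.
  by rewrite KL.
exists (`|v0 - w0| / 2); first by rewrite divr_gt0.
move=> v w Kv Lw; have /= := H (v, w) (mem_set (conj Kv Lw)).
by rewrite [X in _ <= X]prod_normE le_max /far -splitr.
Qed.

Lemma common_scale (R : realType) (I : eqType) (P : I -> R -> Prop) (s : seq I) :
  (forall i e e', 0 < e' -> e' <= e -> P i e -> P i e') ->
  (forall i, i \in s -> exists2 e, 0 < e & P i e) ->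
  exists2 e, 0 < e & forall i, i \in s -> P i e.
Proof.
move=> mono; elim: s => [|i s IH] H; first by exists 1.
have [|e e0 He] := IH; first by move=> j js; apply: H; rewrite inE js orbT.
have [e' e'0 He'] := H i (mem_head _ _).
exists (Num.min e e'); first by rewrite lt_min e0.
move=> j; rewrite inE => /orP[/eqP->|js].
  by apply: mono He' => //; rewrite ?lt_min ?e0 // ge_min lexx orbT.
by apply: mono (He _ js) => //; rewrite ?lt_min ?e0 // ge_min lexx.
Qed.

Lemma far_le (R : realType) (e e' : R) (v w : R * R) :
  e' <= e -> far e v w -> far e' v w.
Proof. by rewrite /far => ee /orP[]h; apply/orP; [left|right]; lra. Qed.

Lemma quadrant_swap (R : realType) (v w : R * R) : v <> w ->
  (quadrant (v - w) : int) = (quadrant (w - v) : int) + 2 +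
    4 * (if (quadrant (w - v)%R < 2)%N then 0 else -1).
Proof.
move=> vw; rewrite -(opprB w v) quadrantN; last first.
  rewrite -negb_and; apply/negP => /andP[/eqP h1 /eqP h2]; apply: vw.
  apply/eqP; rewrite eq_sym -subr_eq0; apply/eqP.
  by rewrite [w - v]surjective_pairing h1 h2.
by move: (quadrant _) (quadrant_lt4 (w - v)) => [|[|[|[|]]]].
Qed.

(** Only edges without a common end must be disjoint, and edges are mere continua. One scale [e]
    separates all such pairs; point sequences at this scale replace the edges, and [winding_grid]
    supplies the relations refuted by [K33_parity]. *)
Lemma K33_nonplanar (R : realType) (A B : nat -> R * R)
    (E : nat -> nat -> set (R * R)) :
  (forall i j, (i < 3)%N -> (j < 3)%N ->
     [/\ compact (E i j), connected (E i j), E i j (A i) & E i j (B j)]) ->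
  (forall i j k l, (i < 3)%N -> (j < 3)%N -> (k < 3)%N -> (l < 3)%N ->
     i != k -> j != l -> E i j `&` E k l = set0) ->
  False.
Proof.
move=> hE dE.
have [e e0 he] : exists2 e : R, 0 < e &
    forall i, i \in enum {: 'I_3 * 'I_3 * ('I_3 * 'I_3)} ->
    i.1.1 != i.2.1 -> i.1.2 != i.2.2 ->
    forall v w, E i.1.1 i.1.2 v -> E i.2.1 i.2.2 w -> far e v w.
  apply: common_scale => [i e e' _ ee H h1 h2 v w Ev Ew|].
    exact: far_le ee (H h1 h2 v w Ev Ew).
  move=> [[i j] [k l]] _ /=.
  have [->|ik] := eqVneq i k; first by exists 1.
  have [->|jl] := eqVneq j l; first by exists 1.
  have [cK _ _ _] := hE i j (ltn_ord i) (ltn_ord j).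
  have [cL _ _ _] := hE k l (ltn_ord k) (ltn_ord l).
  have [e e0 H] := compact_far cK cL
    (dE i j k l (ltn_ord i) (ltn_ord j) (ltn_ord k) (ltn_ord l) ik jl).
  by exists e => // _ _.
have {}he i j k l : (i < 3)%N -> (j < 3)%N -> (k < 3)%N -> (l < 3)%N ->
    i != k -> j != l -> forall v w, E i j v -> E k l w -> far e v w.
  move=> i3 j3 k3 l3 ik jl.
  by apply: (he (Ordinal i3, Ordinal j3, (Ordinal k3, Ordinal l3)));
    rewrite ?mem_enum.
have /choice[s hs] : forall ij : nat * nat, exists s, (ij.1 < 3)%N -> (ij.2 < 3)%N ->
    [/\ path (nearby e) (A ij.1) s, last (A ij.1) s = B ij.2 &
      forall v, v \in A ij.1 :: s -> E ij.1 ij.2 v].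
  move=> [i j] /=; have [i3|?] := ltnP i 3; last by exists [::].
  have [j3|?] := ltnP j 3; last by exists [::].
  have [cE cnE EA EB] := hE i j i3 j3.
  by have [s ps [ls hs]] := connected_chain cnE e0 EA EB; exists s.
have /choice[u hu] : forall kij : nat * (nat * nat), exists k : int,
    winding (A kij.1) (A kij.2.1) (s kij.2) =
    (quadrant (last (A kij.2.1) (s kij.2) - A kij.1))%:Z -
    (quadrant (A kij.2.1 - A kij.1))%:Z + 4 * k by move=> ?; exact: winding_mod.
have /choice[v hv] : forall kij : nat * (nat * nat), exists k : int,
    winding (B kij.1) (A kij.2.1) (s kij.2) =
    (quadrant (last (A kij.2.1) (s kij.2) - B kij.1))%:Z -
    (quadrant (A kij.2.1 - B kij.1))%:Z + 4 * k by move=> ?; exact: winding_mod.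
pose kk (x y : R * R) : int := if (quadrant (x - y)%R < 2)%N then 0 else -1.
have neq i j k l x : (i < 3)%N -> (j < 3)%N -> (k < 3)%N -> (l < 3)%N ->
    i != k -> j != l -> E i j x -> ~ E k l x.
  move=> i3 j3 k3 l3 ik jl h1 h2; have : (E i j `&` E k l) x by [].
  by rewrite dE.
apply: (@K33_parity (fun k i j => u (k, (i, j))) (fun l i j => v (l, (i, j)))
  (fun k i => (quadrant (A i - A k))%:Z) (fun j l => (quadrant (B l - B j))%:Z)
  (fun k j => (quadrant (B j - A k))%:Z) (fun i l => (quadrant (A i - B l))%:Z)
  (fun i k => kk (A i) (A k)) (fun j l => kk (B j) (B l))
  (fun i j => kk (A i) (B j))).
- move=> i k ik; apply: quadrant_swap => Aik.
  have [_ _ h1 _] := hE i 0%N ltac:(lia) isT;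
    have [_ _ h2 _] := hE k 1%N ltac:(lia) isT.
  rewrite Aik in h2; apply: neq h1 h2 => //; lia.
- move=> j l jl; apply: quadrant_swap => Bjl.
  have [_ _ _ h1] := hE 0%N j isT ltac:(lia);
    have [_ _ _ h2] := hE 1%N l isT ltac:(lia).
  rewrite Bjl in h2; apply: neq h1 h2 => //; lia.
- move=> i j i3 j3; apply: quadrant_swap => ABij.
  pose j' := (if j == 0 then 1 else 0)%N;
    pose i' := (if i == 0 then 1 else 0)%N.
  have i'3 : (i' < 3)%N by rewrite /i'; case: ifP.
  have j'3 : (j' < 3)%N by rewrite /j'; case: ifP.
  have ni : i != i' by rewrite /i'; case: (i).
  have nj : j' != j by rewrite /j'; case: (j).
  have [_ _ h1 _] := hE i j' i3 j'3; have [_ _ _ h2] := hE i' j i'3 j3.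
  by rewrite ABij in h2; exact: (neq _ _ _ _ _ i3 j'3 i'3 j3 ni nj h1 h2).
move=> i j k l i3 j3 k3 l3 ik jl.
have [p1 l1 m1] := hs (i, j) i3 j3; have [p2 l2 m2] := hs (k, l) k3 l3.
have := winding_grid e0 p1 p2 (fun x y hx hy => he i j k l i3 j3 k3 l3 ik jl x y (m1 x hx) (m2 y hy)).
rewrite /= in l1 l2 *; rewrite l1 l2.
have := hu (k, (i, j)); have := hv (j, (k, l)); have := hu (i, (k, l));
  have := hv (l, (i, j)).
by rewrite /= l1 l2 => -> -> -> ->.
Qed.

(** * Outerplanar graphs contain no theta subgraph *)

Definition continuum (T : topologicalType) (K : set T) :=
  compact K /\ connected K.

Lemma continuumU (T : topologicalType) (K L : set T) x :
  K x -> L x -> continuum K -> continuum L -> continuum (K `|` L).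
Proof.
move=> Kx Lx [cK nK] [cL nL]; split; first exact: compactU.
by apply: connectedU => //; exists x.
Qed.

Lemma continuum_image (R : realType) (T : topologicalType) (g : R -> T) (a b : R) :
  {within `[a, b], continuous g} -> continuum (g @` `[a, b]).
Proof.
move=> cg; split; first by apply: continuous_compact => //;
  exact: segment_compact.
by apply: connected_continuous_connected => //; exact: segment_connected.
Qed.

Definition segment (R : realType) (v w : R * R) : set (R * R) :=
  (fun t : R => v + t *: (w - v)) @` `[0, 1].

Lemma segment_continuum (R : realType) (v w : R * R) : continuum (segment v w).
Proof.
apply: continuum_image; apply: continuous_subspaceT => t.
by apply: cvgD; [exact: cvg_cst|apply: cvgZl; exact: cvg_id].
Qed.

Lemma segment0 (R : realType) (v w : R * R) : segment v w v.
Proof. by exists 0; rewrite ?scale0r ?addr0 //= in_itv /= lexx ler01. Qed.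

Lemma segment1 (R : realType) (v w : R * R) : segment v w w.
Proof. by exists 1;
  [rewrite /= in_itv /= lexx ler01|rewrite scale1r addrC subrK]. Qed.

Lemma segment_ball (R : realType) (v w : R * R) r :
  ball v r w -> segment v w `<=` ball v r.
Proof.
rewrite -!ball_normE /= => vw _ [t /= + <-]; rewrite in_itv /= => /andP[t0 t1].
rewrite opprD addrA subrr sub0r normrN normrZ ger0_norm // distrC.
by apply: le_lt_trans vw; rewrite ler_piMl.
Qed.

(** The points of [F] joined to [x] by a continuum inside [U] are open and closed in [F], because
    segments inside small balls extend the continuum. *)
Lemma continuum_in_open (R : realType) (U F : set (R * R)) x y :
  open U -> connected F -> F `<=` U -> F x -> F y ->
  exists2 K, continuum K & [/\ K `<=` U, K x & K y].
Proof.
move=> oU cF FU Fx Fy.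
pose B := [set y | F y /\ exists2 K, continuum K & [/\ K `<=` U, K x & K y]].
suff BF : B = F by have : B y; [rewrite BF|case].
have /choice[r hr] : forall w, exists r : R, F w -> 0 < r /\ ball w r `<=` U.
  move=> w; have [/FU Uw|nF] := pselect (F w); last by exists 0 => /nF.
  by have /nbhs_ballP[r r0 h] := oU w Uw; exists r.
(* Radii depend on the centre, so both directions are kept: the first gives openness, the second
   closedness. *)
have step w z : B w -> F z -> (ball w (r w) z \/ ball z (r z) w) -> B z.
  move=> [Fw [K cK [KU Kx Kw]]] Fz h; split=> //.
  have [[rw0 bw] [rz0 bz]] := (hr w Fw, hr z Fz).
  have [S cS [SU Sw Sz]] : exists2 S, continuum S & [/\ S `<=` U, S w & S z].
    case: h => h; [exists (segment w z)|exists (segment z w)];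
      try exact: segment_continuum.
    - by split; [move=> t /(segment_ball h)/bw|exact: segment0|exact: segment1].
    - by split; [move=> t /(segment_ball h)/bz|exact: segment1|exact: segment0].
  exists (K `|` S); first exact: (@continuumU _ _ _ w).
  by split; [move=> t [/KU|/SU]|left|right].
apply: cF.
- exists x; split=> //; exists [set x]; first by split;
    [exact: compact_set1|exact: connected1].
  by split=> // t ->; exact: FU.
- exists (\bigcup_(w in B) ball w (r w)).
    by apply: bigcup_open => w _; exact: ball_open.
  apply/seteqP; split=> [z Bz|z [Fz [w Bw wz]]]; last by apply: step Bw Fz _;
    left.
  have [Fz _] := Bz; split=> //; exists z => //.
  by apply: ballxx; have [] := hr z Fz.
- exists (~` \bigcup_(w in F `\` B) ball w (r w)).
    by apply/open_closedC/bigcup_open => w _; exact: ball_open.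
  apply/seteqP; split=> z.
    move=> Bz; have [Fz _] := Bz; split=> // -[w [Fw nBw] wz]; apply: nBw.
    by apply: step Bz Fw _; right.
  move=> [Fz nz]; apply: contrapT => nBz; apply: nz.
  by exists z => //; apply: ballxx; have [] := hr z Fz.
Qed.

(** Take a nearest point of [D]: a point of [D] strictly inside the segment would be closer to
    [y]. *)
Lemma nearest_point (R : realType) (D : set (R * R)) y z0 :
  compact D -> D z0 -> exists2 z, D z &
    `|y - z| <= `|y - z0| /\ segment y z `<=` ~` D `|` [set z].
Proof.
move=> cD Dz0.
have cont : {within D, continuous (fun z : R * R => `|y - z|)}.
  apply: continuous_subspaceT => z; apply: cvg_norm.
  by apply: cvgB; [exact: cvg_cst|exact: cvg_id].
have [z /set_mem Dz H] := compact_EVT_min (ex_intro _ z0 Dz0) cD cont.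
exists z => //; split; first by apply: H; exact: mem_set.
move=> _ [t /= + <-]; rewrite in_itv /= => /andP[t0 t1].
have [->|tn1] := eqVneq t 1; first by right; rewrite scale1r addrC subrK.
have [->|yz] := eqVneq z y; first by right; rewrite subrr scaler0 addr0.
left=> /mem_set/H; rewrite opprD addrA subrr sub0r normrN normrZ ger0_norm //.
apply/negP; rewrite -ltNge distrC gtr_pMl ?normr_gt0 ?subr_eq0 // 1?eq_sym //.
by rewrite lt_neqAle tn1.
Qed.

(** Cut the parameter interval at a parameter of [z]; injectivity keeps each piece off the opposite
    end unless [z] is that end. *)
Lemma arc_split (R : realType) (G : sgraph) p a (x y : G) z :
  @plane_drawing R G p a -> adj x y ->
  arc_image (a [set x; y]%SET) z ->
  exists K L, [/\ continuum K, continuum L, K `|` L `<=` arc_image (a [set x; y]%SET),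
    [/\ K (p x), K z & K (p y) -> z = p y] & [/\ L (p y), L z & L (p x) -> z = p x]].
Proof.
move=> dr xy [t tI zt]; set e := [set x; y]%SET in zt *.
have eE : e \in edges G by apply/edgesP; exists x, y.
have cont := drawing_arc_continuous dr eE; have inj := drawing_arc_inj dr eE.
have ends := drawing_arc_ends dr eE.
have [t0 t1] : 0 <= t /\ t <= 1 by move: tI; rewrite /= in_itv /= => /andP.
have I0 : (0 : R) \in `[0, 1]%R by rewrite in_itv /= lexx ler01.
have I1 : (1 : R) \in `[0, 1]%R by rewrite in_itv /= lexx ler01.
pose K := a e @` `[0, t]; pose L := a e @` `[t, 1].
have cK : continuum K.
  apply: continuum_image; apply: continuous_subspaceW cont.
  by move=> s /=; rewrite !in_itv /= => /andP[-> h]; exact: le_trans h t1.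
have cL : continuum L.
  apply: continuum_image; apply: continuous_subspaceW cont.
  by move=> s /=; rewrite !in_itv /= => /andP[h ->]; rewrite (le_trans t0 h).
have KL : K `|` L `<=` arc_image (a e).
  move=> _ [] [s /= + <-]; rewrite in_itv /= => /andP[h1 h2];
    exists s => //=; rewrite in_itv /=.
    by rewrite h1 (le_trans h2 t1).
  by rewrite h2 (le_trans t0 h1).
have K0 : K (a e 0) by exists 0 => //=; rewrite in_itv /= lexx.
have Kz : K z by exists t => //=; rewrite in_itv /= t0 lexx.
have Lz : L z by exists t => //=; rewrite in_itv /= t1 lexx.
have L1 : L (a e 1) by exists 1 => //=; rewrite in_itv /= t1 lexx.
have K1 : K (a e 1) -> z = a e 1.
  move=> [s /= + es]; rewrite in_itv /= => /andP[h1 h2].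
  have sI : s \in `[0, 1]%R by rewrite in_itv /= h1 (le_trans h2 t1).
  have s1' := inj s 1 sI I1 es.
  by rewrite -zt; congr (a e _); apply/eqP; rewrite eq_le t1 -s1'.
have L0 : L (a e 0) -> z = a e 0.
  move=> [s /= + es]; rewrite in_itv /= => /andP[h1 h2].
  have sI : s \in `[0, 1]%R by rewrite in_itv /= h2 (le_trans t0 h1).
  have s1' := inj s 0 sI I0 es.
  by rewrite -zt; congr (a e _); apply/eqP; rewrite eq_le t0 andbT -s1'.
have xney : p x <> p y.
  by move/(drawing_vertex_inj dr) => h; move: xy; rewrite h adj_irrefl.
have px : [set a e 0; a e 1] (p x).
  by rewrite ends; exists x => //; rewrite /= !inE eqxx.
have py : [set a e 0; a e 1] (p y).
  by rewrite ends; exists y => //; rewrite /= !inE eqxx orbT.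
(* The arc may be parametrised from [y] to [x]; then the two pieces exchange roles. *)
case: px py => px [] py; try by case: xney; rewrite px py.
- by exists K, L; rewrite px py; split.
- by exists L, K; rewrite px py setUC; split.
Qed.

Fixpoint trail (R : realType) (G : sgraph) (p : G -> R * R)
    (a : {set G} -> R -> R * R) (x : G) (s : seq G) : set (R * R) :=
  if s is y :: s' then arc_image (a [set x; y]%SET) `|` trail p a y s'
  else [set p x].

Fixpoint trail_edges (G : sgraph) (x : G) (s : seq G) : seq {set G} :=
  if s is y :: s' then [set x; y]%SET :: trail_edges y s' else [::].

Lemma arc_ends (R : realType) (G : sgraph) p a (x y : G) :
  @plane_drawing R G p a -> adj x y ->
  arc_image (a [set x; y]%SET) (p x) /\ arc_image (a [set x; y]%SET) (p y).
Proof.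
move=> dr xy; have eE : [set x; y]%SET \in edges G by apply/edgesP; exists x, y.
have ends := drawing_arc_ends dr eE.
have H v : v \in [set x; y]%SET -> arc_image (a [set x; y]%SET) (p v).
  move=> ve; have : (p @` [set` [set x; y]%SET]) (p v) by exists v.
  by rewrite -ends => -[->|->]; [exists 0|exists 1];
    rewrite //= in_itv /= lexx ler01.
by split; apply: H; rewrite !inE eqxx ?orbT.
Qed.

Lemma arc_image_cases (R : realType) (G : sgraph) p a (x y : G) z :
  @plane_drawing R G p a -> adj x y -> arc_image (a [set x; y]%SET) z ->
  [\/ z = p x, z = p y | arc_interior (a [set x; y]%SET) z].
Proof.
move=> dr xy [t /= + <-]; rewrite in_itv /= !le_eqVlt.
have eE : [set x; y]%SET \in edges G by apply/edgesP; exists x, y.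
have ends := drawing_arc_ends dr eE.
have H t' : [set a [set x; y]%SET 0; a [set x; y]%SET 1] (a [set x; y]%SET t') ->
   a [set x; y]%SET t' = p x \/ a [set x; y]%SET t' = p y.
  by rewrite ends => -[v /= + <-]; rewrite !inE => /orP[]/eqP->; [left|right].
case/andP=> /orP[/eqP<- _|t0 /orP[/eqP->|t1]].
- by case: (H 0 (or_introl erefl)) => h; [constructor 1|constructor 2].
- by case: (H 1 (or_intror erefl)) => h; [constructor 1|constructor 2].
- by constructor 3; exists t => //=; rewrite in_itv /= t0.
Qed.

Lemma trail_cases (R : realType) (G : sgraph) p a (x : G) s z :
  @plane_drawing R G p a -> path (@adj G) x s -> trail p a x s z ->
  (exists2 v, v \in x :: s & z = p v) \/
  (exists2 e, e \in trail_edges x s & arc_interior (a e) z).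
Proof.
move=> dr; elim: s x => [|y s IH] x /=.
  by move=> _ ->; left; exists x; rewrite ?mem_head.
case/andP=> xy ys [|/(IH y ys)[[v vs ->]|[e es ez]]].
- case/(arc_image_cases dr xy) => [->|->|h].
  + by left; exists x; rewrite ?mem_head.
  + by left; exists y; rewrite ?inE ?eqxx ?orbT.
  + by right; exists [set x; y]%SET; rewrite ?mem_head.
- by left; exists v; rewrite // inE vs orbT.
- by right; exists e; rewrite // inE es orbT.
Qed.

Lemma trail_edges_sub (G : sgraph) (x : G) s e : e \in trail_edges x s ->
  {subset e <= x :: s}.
Proof.
elim: s x => //= y s IH x; rewrite inE => /orP[/eqP->|/IH h] v.
  by rewrite !inE => /orP[]->; rewrite ?orbT.
by move/h => h'; rewrite inE h' orbT.
Qed.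

Lemma trail_edges_in (G : sgraph) (x : G) s e : path (@adj G) x s ->
  e \in trail_edges x s -> e \in edges G.
Proof.
elim: s x => //= y s IH x /andP[xy ys];
  rewrite inE => /orP[/eqP->|/(IH y ys)//].
by apply/edgesP; exists x, y.
Qed.

(** This is why internally disjoint paths with inner vertices share no edge. *)
Lemma trail_edges_meet (G : sgraph) (x y : G) s e : s != [::] ->
  e \in trail_edges x (rcons s y) -> exists2 v, v \in s & v \in e.
Proof.
case: s => // z s _ /=; rewrite inE => /orP[/eqP->|].
  by exists z; rewrite !inE eqxx ?orbT.
elim: s z {x} => [|w s IH] z /=; rewrite !inE.
  by move=> /eqP->; exists z; rewrite !inE eqxx.
case/orP=> [/eqP->|/IH[v vs ve]]; first by exists z; rewrite !inE eqxx.
by exists v => //; rewrite inE vs orbT.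
Qed.

Lemma trail_ends (R : realType) (G : sgraph) p a (x : G) s :
  @plane_drawing R G p a -> path (@adj G) x s ->
  trail p a x s (p x) /\ trail p a x s (p (last x s)).
Proof.
move=> dr; elim: s x => [|y s IH] x //= /andP[xy ys].
have [h1 _] := arc_ends dr xy; have [_ h2] := IH y ys.
by split; [left|right].
Qed.

Lemma trail_mem (R : realType) (G : sgraph) p a (x : G) s v :
  @plane_drawing R G p a -> path (@adj G) x s -> v \in x :: s ->
  trail p a x s (p v).
Proof.
move=> dr; elim: s x => [|y s IH] x /=; first by rewrite inE => _ /eqP->.
case/andP=> xy ys; rewrite inE => /orP[/eqP->|/(IH y ys)]; last by right.
by left; have [] := arc_ends dr xy.
Qed.

Lemma trail_continuum (R : realType) (G : sgraph) p a (x : G) s :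
  @plane_drawing R G p a -> path (@adj G) x s -> continuum (trail p a x s).
Proof.
move=> dr; elim: s x => [|y s IH] x //=.
  by move=> _; split; [exact: compact_set1|exact: connected1].
case/andP=> xy ys; have [_ h1] := arc_ends dr xy.
have [h2 _] := trail_ends dr ys.
apply: continuumU h1 h2 _ (IH y ys); apply: continuum_image.
by apply: (drawing_arc_continuous dr); apply/edgesP; exists x, y.
Qed.

Lemma trail_vertex (R : realType) (G : sgraph) p a (x : G) s v :
  @plane_drawing R G p a -> path (@adj G) x s -> trail p a x s (p v) ->
  v \in x :: s.
Proof.
move=> dr ps /(trail_cases dr ps)[[w ws /(drawing_vertex_inj dr)->//]|].
by move=> [e /(trail_edges_in ps) eE] /(drawing_arc_vertex dr eE).
Qed.

Lemma trail_sub (R : realType) (G : sgraph) (p : G -> R * R)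
    (a : {set G} -> R -> R * R) (x : G) s :
  path (@adj G) x s -> trail p a x s `<=` drawing_set p a.
Proof.
elim: s x => [|y s IH] x /=; first by move=> _ _ ->; left; exists x.
case/andP=> xy ys z [h|/(IH y ys)//]; right; exists [set x; y]%SET => //=.
by apply/edgesP; exists x, y.
Qed.

Lemma arc_last (R : realType) (G : sgraph) p a (x y : G) s :
  @plane_drawing R G p a -> adj x y -> uniq [:: x, y & s] ->
  arc_image (a [set x; y]%SET) (p (last y s)) -> s = [::].
Proof.
case: s => // w s dr xy us.
have eE : [set x; y]%SET \in edges G by apply/edgesP; exists x, y.
have lw : last y (w :: s) \in w :: s by rewrite /= mem_last.
case/(arc_image_cases dr xy) => [/(drawing_vertex_inj dr) e|
  /(drawing_vertex_inj dr) e|/(drawing_arc_vertex dr eE)//].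
- by move: us; rewrite e in lw; rewrite cons_uniq inE lw orbT.
- by move: us; rewrite e in lw; rewrite 2!cons_uniq lw /= andbF.
Qed.

Lemma trail_split (R : realType) (G : sgraph) p a (x : G) s z :
  @plane_drawing R G p a -> path (@adj G) x s -> uniq (x :: s) ->
  trail p a x s z ->
  exists K L, [/\ continuum K, continuum L, K `|` L `<=` trail p a x s,
    [/\ K (p x), K z & K (p (last x s)) -> z = p (last x s)] &
    [/\ L (p (last x s)), L z & L (p x) -> z = p x]].
Proof.
move=> dr; elim: s x => [|y s IH] x /=.
  move=> _ _ ->; have c1 : continuum [set p x].
    by split; [exact: compact_set1|exact: connected1].
  by exists [set p x], [set p x]; split=> // t [].
case/andP=> xy ys /andP[xs us]; case.
- move=> h; have [K [L [cK cL KL [Kx Kz Ky] [Ly Lz Lx]]]] := arc_split dr xy h.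
  have [ty tl] := trail_ends dr ys; exists K, (L `|` trail p a y s); split=> //.
  + exact: continuumU Ly ty cL (trail_continuum dr ys).
  + by move=> t [Kt|[Lt|?]];
      [left; apply: KL; left|left; apply: KL; right|right].
  + split=> // Kl; have s0 : s = [::].
      by apply: (arc_last dr xy); [rewrite /= xs|apply: KL; left].
    by rewrite s0 in Kl *; exact: Ky.
  + split=> //; [by right|by left|].
    by move=> [/Lx//|/(trail_vertex dr ys) h']; rewrite h' in xs.
- move=> h; have [K [L [cK cL KL [Kx Kz Ky] [Ly Lz Lx]]]] := IH y ys us h.
  have [ax ay] := arc_ends dr xy.
  exists (arc_image (a [set x; y]%SET) `|` K), L; split=> //.
  + apply: continuumU ay Kx _ cK; apply: continuum_image.
    by apply: (drawing_arc_continuous dr); apply/edgesP; exists x, y.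
  + by move=> t [[?|Kt]|Lt];
      [left|right; apply: KL; left|right; apply: KL; right].
  + split; [by left|by right|].
    move=> [al|/Ky//]; have s0 : s = [::].
      by apply: (arc_last dr xy) => //; rewrite /= xs.
    by move: h; rewrite s0.
  + split=> // Lpx; have : trail p a y s (p x) by apply: KL; right.
    by move/(trail_vertex dr ys) => h'; rewrite h' in xs.
Qed.

Lemma trail_meet (R : realType) (G : sgraph) p a (u v : G) s t z :
  @plane_drawing R G p a -> s != [::] -> t != [::] ->
  path (@adj G) u (rcons s v) -> path (@adj G) u (rcons t v) ->
  uniq (u :: rcons s v) ->
  (forall x, x \in s -> x \notin t) ->
  trail p a u (rcons s v) z -> trail p a u (rcons t v) z ->
  z = p u \/ z = p v.
Proof.
move=> dr s0 t0 ps pt us st.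
have mem r x : x \in u :: rcons r v = [|| x == u, x == v | x \in r].
  by rewrite inE mem_rcons inE.
have suv x : x \in s -> (x == u) || (x == v) = false.
  move=> xs; apply/negbTE; apply/negP; move: us.
  rewrite /= mem_rcons rcons_uniq inE negb_or => /and3P[/andP[_ us] vs _].
  by case/orP=> /eqP e; rewrite e in xs; rewrite xs in us vs.
case/(trail_cases dr ps)=> [[x xs ->]|[e es ez]];
  case/(trail_cases dr pt)=> [[y yt]|[f ft fz]].
- move/(drawing_vertex_inj dr) => xy; rewrite -xy in yt; move: xs yt;
    rewrite !mem.
  case/or3P=> [/eqP->|/eqP->|xs]; [by left|by right|].
  by rewrite orbA (suv x xs) /= (negPf (st x xs)).
- by case: (drawing_arc_vertex dr (trail_edges_in pt ft) fz).
- by move=> zy; rewrite zy in ez;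
    case: (drawing_arc_vertex dr (trail_edges_in ps es) ez).
- have [ef|ef] := eqVneq e f; last first.
    have := drawing_arc_arc dr (trail_edges_in ps es) (trail_edges_in pt ft) (elimN eqP ef).
    move/seteqP=> [/(_ z) h _]; case: h; split=> //.
    by move: fz => [r /= + <-]; rewrite in_itv /= => /andP[r0 r1]; exists r;
      rewrite //= in_itv /= !ltW.
  have [x xs xe] := trail_edges_meet s0 es.
  have : x \in u :: rcons t v by apply: trail_edges_sub ft _ _; rewrite -ef.
  by rewrite mem orbA (suv x xs) /= (negPf (st x xs)).
Qed.

(** A K33 is built with [u], [v] and a point of the outer face on one side, and one contact point on
    each of the three paths on the other. Cutting path [j] at its contact point gives the edges from
    [u] and [v]. *)
Lemma outerplanar_theta_free (R : realType) (G : sgraph) :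
  outerplanar R G -> theta_free G.
Proof.
move=> [p [a [dr [F [[x0 x0D FE] _] bd]]]] u v P HP disj.
have cF : connected F by rewrite FE; exact: component_connected.
have FD : F `<=` ~` drawing_set p a by rewrite FE;
  exact: connected_component_sub.
pose T j := trail p a u (rcons (P j) v).
have Tc j : (j < 3)%N -> continuum (T j).
  by move=> /HP[_ h _]; exact: trail_continuum.
have Tm j l z : (j < 3)%N -> (l < 3)%N -> j != l -> T j z -> T l z -> z = p u \/ z = p v.
  move=> j3 l3 jl; have [h1 h2 h3] := HP j j3; have [h1' h2' h3'] := HP l l3.
  by apply: trail_meet => // x; apply: disj.
have [Tu Tv] : (forall j, (j < 3)%N -> T j (p u)) /\ (forall j, (j < 3)%N -> T j (p v)).
  by split=> j /HP[_ h _]; have := trail_ends dr h; rewrite last_rcons => -[].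
pose D := T 0%N `|` T 1%N `|` T 2%N.
have DT z : D z <-> exists2 j, (j < 3)%N & T j z.
  split=> [[[h|h]|h]|[[|[|[|//]]] _ h]];
    [by exists 0%N|by exists 1%N|by exists 2%N|..].
  - by left; left.
  - by left; right.
  - by right.
have cD : compact D.
  by apply: compactU; [apply: compactU|]; apply: (proj1 (Tc _ _)).
have oD : open (~` D) by apply: closed_openC; apply: compact_closed => //;
  exact: norm_hausdorff.
have FD' : F `<=` ~` D.
  by move=> z /FD Dz /DT[j /HP[_ h _] Tz]; apply: Dz; exact: trail_sub Tz.
have /choice[yz hyz] : forall j, exists yz : (R * R) * (R * R), (j < 3)%N ->
    [/\ F yz.1, T j yz.2, segment yz.1 yz.2 `<=` ~` D `|` [set yz.2] &
        forall l, (l < 3)%N -> l != j -> ~ T l yz.2].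
  move=> j; have [j3|_] := ltnP j 3; last by exists (0, 0).
  have [Pj0 hp hu] := HP j j3.
  have [x xP] : exists x, x \in P j by case: (P j) Pj0 => // x s; exists x;
    rewrite mem_head.
  have xuv : (x != u) && (x != v).
    move: hu; rewrite /= mem_rcons rcons_uniq inE negb_or => /and3P[/andP[_ us] vs _].
    by apply/andP; split; apply/eqP => e; rewrite e in xP; rewrite xP in us vs.
  have nT l : (l < 3)%N -> l != j -> ~ T l (p x).
    move=> l3 lj; have [_ hl _] := HP l l3.
    move/(trail_vertex dr hl);
      rewrite inE mem_rcons inE orbA -negb_or -?negb_or in xuv *.
    by rewrite (negPf xuv) /=; apply/negP; apply: disj xP => //; rewrite eq_sym.
  (* Around the inner vertex [x], a ball of radius [r] misses the other two paths. *)
  have [r r0 hr] : exists2 r : R, 0 < r & forall l, l \in iota 0 3 -> l != j ->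
      forall z, ball (p x) r z -> ~ T l z.
    apply: common_scale => [l e e' _ ee h lj z bz|l]; first by apply: h => //;
      exact: le_ball bz.
    rewrite mem_iota => /andP[_ l3]; have [->|lj] := eqVneq l j;
      first by exists 1.
    have oT : open (~` T l).
      by apply: closed_openC; apply: compact_closed (proj1 (Tc _ l3));
        exact: norm_hausdorff.
    by have /nbhs_ballP[r r0 hr] := oT _ (nT l l3 lj); exists r.
  have [cl _] := bd x.
  (* The face point [y] is within [r / 2] of [p x], and its nearest point of [D] is no farther from
     [y] than [p x]; hence that point is within [r] of [p x] and lies on path [j] only. *)
  have [y [Fy by_]] := cl _ (nbhsx_ballx (p x) (r / 2) (divr_gt0 r0 (ltr0n _ 2))).
  have Tx : T j (p x).
    by apply: trail_mem => //; rewrite inE mem_rcons inE xP !orbT.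
  have Dx : D (p x) by apply/DT; exists j.
  have [z Dz [yz sg]] := nearest_point y cD Dx.
  have bz : ball (p x) r z.
    rewrite -ball_normE /= in by_ *.
    rewrite (splitr r) (le_lt_trans (ler_distD y _ _)) // ltrD //.
    by rewrite (le_lt_trans yz) // distrC.
  have Tz l : (l < 3)%N -> l != j -> ~ T l z.
    by move=> l3 lj; apply: hr => //; rewrite mem_iota.
  exists (y, z) => _; split=> //=; have /DT[l l3 Tl] := Dz.
  by have [<-//|lj] := eqVneq l j; case: (Tz l l3 lj).
have w0 : F (yz 0%N).1 by have [] := hyz 0%N isT.
have /choice[K hK] : forall j, exists K, (j < 3)%N -> continuum K /\
    [/\ K `<=` ~` D, K (yz 0%N).1 & K (yz j).1].
  move=> j; have [j3|_] := ltnP j 3; last by exists set0.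
  have [Fj _ _ _] := hyz j j3.
  by have [K cK hK] := continuum_in_open oD cF FD' w0 Fj; exists K.
have /choice[LL hL] : forall j, exists LL : set (R * R) * set (R * R), (j < 3)%N ->
    [/\ continuum LL.1, continuum LL.2, LL.1 `|` LL.2 `<=` T j,
     [/\ LL.1 (p u), LL.1 (yz j).2 & ~ LL.1 (p v)] &
     [/\ LL.2 (p v), LL.2 (yz j).2 & ~ LL.2 (p u)]].
  move=> j; have [j3|_] := ltnP j 3; last by exists (set0, set0).
  have [_ Tz _ nTz] := hyz j j3; have [_ hp hu] := HP j j3.
  have [L1 [L2 [c1 c2 LT]]] := trail_split dr hp hu Tz.
  rewrite last_rcons => -[K1 K2 K3] [K4 K5 K6].
  (* Both ends lie on every path but the contact point on path [j] alone; any other index shows that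
     it is not an end. *)
  have [l l3 lj] : exists2 l, (l < 3)%N & l != j by exists (if j == 0 then 1 else 0)%N; case: (j).
  exists (L1, L2) => _; split=> //; split=> //=.
    by move/K3 => e; apply: (nTz l l3 lj); rewrite e; exact: Tv.
  by move/K6 => e; apply: (nTz l l3 lj); rewrite e; exact: Tu.
(* The sets [K j] may overlap, which is harmless: they belong to edges with a common end. *)
pose E i j := match i with 0%N => (LL j).1 | 1%N => (LL j).2
  | _ => K j `|` segment (yz j).1 (yz j).2 end.
pose A i := match i with 0%N => p u | 1%N => p v | _ => (yz 0%N).1 end.
apply: (@K33_nonplanar R A (fun j => (yz j).2) E).
- move=> i j i3 j3; have [[c1 n1] [c2 n2] _ [h1 h2 _] [h3 h4 _]] := hL j j3.
  have [cK [KD K0 Kj]] := hK j j3.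
  have [cU nU] := continuumU Kj (segment0 _ _) cK (segment_continuum (yz j).1 (yz j).2).
  case: i i3 => [|[|[|]]] //= _; split=> //; first by left.
  by right; exact: segment1.
have LTD j l z : (j < 3)%N -> (l < 3)%N -> j != l -> T j z ->
    ~ (K l `|` segment (yz l).1 (yz l).2) z.
  move=> j3 l3 jl Tz; have [_ [KD _ _]] := hK l l3;
    have [_ _ sg nT] := hyz l l3.
  have Dz : D z by apply/DT; exists j.
  by case=> [/KD//|/sg[//|/= e]]; apply: (nT j j3 jl); rewrite -e.
have sub1 j z : (j < 3)%N -> (LL j).1 z -> T j z.
  by move=> /hL[_ _ h _ _] ?; apply: h; left.
have sub2 j z : (j < 3)%N -> (LL j).2 z -> T j z.
  by move=> /hL[_ _ h _ _] ?; apply: h; right.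
have L12 j l z : (j < 3)%N -> (l < 3)%N -> j != l -> (LL j).1 z -> ~ (LL l).2 z.
  move=> j3 l3 jl h1 h2; have [_ _ _ [_ _ nv] _] := hL j j3.
  have [_ _ _ _ [_ _ nu]] := hL l l3.
  by case: (Tm j l z j3 l3 jl (sub1 _ _ j3 h1) (sub2 _ _ l3 h2)) => e;
    rewrite e in h1 h2.
move=> i j k l i3 j3 k3 l3 ik jl; apply/seteqP; split=> // z [].
have lj : l != j by rewrite eq_sym.
case: i i3 ik => [|[|[|]]] //= _; case: k k3 => [|[|[|]]] //= _ _ h1 h2.
- exact: L12 jl h1 h2.
- by apply: (LTD j l z) => //; exact: sub1.
- exact: L12 lj h2 h1.
- by apply: (LTD j l z) => //; exact: sub2.
- by apply: (LTD l j z) => //; exact: sub1.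
- by apply: (LTD l j z) => //; exact: sub2.
Qed.

(** * Drawing graphs on a line *)

Definition edge_hi (G : sgraph) (f : G -> nat) (e : {set G}) : nat :=
  \max_(x in e) f x.

(** On a two-element set, the sum minus the maximum is the minimum. *)
Definition edge_lo (G : sgraph) (f : G -> nat) (e : {set G}) : nat :=
  (\sum_(x in e) f x - edge_hi f e)%N.

(* Vertices are placed on a horizontal line and each edge is drawn as the
   parabola through its ends whose height at abscissa [X] is
   [- (X - lo) * (hi - X)], so that nested edges do not meet. *)
Definition line_point (R : realType) (G : sgraph) (f : G -> nat) (v : G) : R * R :=
  ((f v)%:R, 0).

Definition line_arc (R : realType) (G : sgraph) (f : G -> nat) (e : {set G})
    (t : R) : R * R :=
  let l := (edge_lo f e)%:R in let h := (edge_hi f e)%:R in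
  (l + t * (h - l), - (t * (1 - t) * (h - l) ^+ 2)).

Lemma edge_lo_hi (G : sgraph) (f : G -> nat) (x y : G) : (f x < f y)%N ->
  edge_lo f [set x; y]%SET = f x /\ edge_hi f [set x; y]%SET = f y.
Proof.
move=> xy; have nxy : x \notin [set y]%SET by rewrite inE;
  apply: contraTneq xy => ->; rewrite ltnn.
rewrite /edge_lo /edge_hi !big_setU1 //= !big_set1 /maxn xy.
by rewrite addnK.
Qed.

Lemma edge_sorted (G : sgraph) (f : G -> nat) (e : {set G}) : injective f ->
  e \in edges G -> exists x y, [/\ adj x y, (f x < f y)%N, e = [set x; y]%SET,
    edge_lo f e = f x & edge_hi f e = f y].
Proof.
move=> fi /edgesP[x [y [xy ->]]].
have nxy : f x != f y by apply: contraTneq xy => /fi->; rewrite adj_irrefl.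
have [lt|gt|eq] := ltngtP (f x) (f y); last by rewrite eq eqxx in nxy.
  by have [h1 h2] := edge_lo_hi lt; exists x, y.
by have [h1 h2] := edge_lo_hi gt; exists y, x; rewrite adj_sym finset.setUC.
Qed.

(** The half-plane is star-shaped about [(0, 1)]. *)
Lemma upper_half_plane_connected (R : realType) :
  connected [set z : R * R | 0 < z.2].
Proof.
have -> : [set z : R * R | 0 < z.2] =
    \bigcup_(z in [set z : R * R | 0 < z.2]) segment (0, 1) z.
  apply/seteqP; split=> [z z0|w [z /= z0 [t /= + <-]]].
    by exists z => //; exact: segment1.
  rewrite in_itv /= => /andP[t0 t1].
  rewrite -[X in 0 < X]/(1 + t * (z.2 - 1)).
  have [->|tn] := eqVneq t 0; first by rewrite mul0r addr0.
  have tp : 0 < t by rewrite lt_neqAle eq_sym tn.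
  by have := mulr_gt0 tp z0; lra.
apply: bigcup_connected; first by exists (0, 1) => z _; exact: segment0.
by move=> z _; have [] := segment_continuum (0, 1) z.
Qed.

(** Split [X - l] at [l'] and [h - X] at [h']: the extra terms of the product are nonnegative and
    one is positive. Hence parabolas over distinct nested intervals do not meet over the open inner
    one. *)
Lemma ltr_mul_nested (R : realType) (X l h l' h' : R) :
  l' < X < h' -> l <= l' -> h' <= h -> (l < l') || (h' < h) ->
  (X - l') * (h' - X) < (X - l) * (h - X).
Proof.
move=> /andP[lX Xh] ll hh ne.
have [A B] : 0 < X - l' /\ 0 < h' - X by rewrite !subr_gt0.
have -> : (X - l) * (h - X) = (X - l') * (h' - X) + (l' - l) * (h' - X) +
    (X - l') * (h - h') + (l' - l) * (h - h') by ring.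
have d0 : 0 <= (l' - l) * (h - h') by rewrite mulr_ge0 // subr_ge0.
case/orP: ne => ne.
  have : 0 < (l' - l) * (h' - X) by rewrite mulr_gt0 // subr_gt0.
  have : 0 <= (X - l') * (h - h') by rewrite mulr_ge0 ?subr_ge0 // ltW.
  by lra.
have : 0 <= (l' - l) * (h' - X) by rewrite mulr_ge0 ?subr_ge0 // ltW.
have : 0 < (X - l') * (h - h') by rewrite mulr_gt0 // subr_gt0.
by lra.
Qed.

(** All arcs lie on or below the axis carrying the vertices, so the open upper half-plane is
    contained in one unbounded face, whose closure contains every vertex. *)
Lemma noncrossing_outerplanar (R : realType) (G : sgraph) (f : G -> nat) :
  injective f ->
  (forall x y z w, adj x y -> adj z w -> (f x < f z < f y)%N -> (f x <= f w <= f y)%N) ->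
  outerplanar R G.
Proof.
move=> fi nc; exists (line_point R f), (@line_arc R G f).
have lohi e : e \in edges G -> ((edge_lo f e)%:R < (edge_hi f e)%:R :> R).
  by case/(edge_sorted fi) => x [y [_ xy _ -> ->]]; rewrite ltr_nat.
have height e t : (line_arc f e t).2 = - (((line_arc f e t).1 - (edge_lo f e)%:R) *
    ((edge_hi f e)%:R - (line_arc f e t).1)) :> R.
  rewrite /line_arc /=; ring.
have dr : plane_drawing (line_point R f) (@line_arc R G f).
  split.
  - by move=> u v [] /eqP; rewrite eqr_nat => /eqP/fi.
  - move=> e eE; apply: continuous_subspaceT => t.
    set l : R := (edge_lo f e)%:R; set h : R := (edge_hi f e)%:R.
    have c1 : l + r * (h - l) @[r --> t] --> l + t * (h - l).
      apply: cvgD; first exact: cvg_cst.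
      by apply: cvgM; [exact: cvg_id|exact: cvg_cst].
    have c2 : - (r * (1 - r) * (h - l) ^+ 2) @[r --> t] --> - (t * (1 - t) * (h - l) ^+ 2).
      apply: cvgN; apply: cvgM; last exact: cvg_cst.
      apply: cvgM; first exact: cvg_id.
      by apply: cvgB; [exact: cvg_cst|exact: cvg_id].
    exact: (cvg_pair c1 c2).
  - move=> e eE t t' _ _ [] /addrI/mulIf h _; apply: h.
    by rewrite subr_eq0 gt_eqF // lohi.
  - move=> e eE; have [x [y [_ xy eS h1 h2]]] := edge_sorted fi eE.
    have a0 : line_arc f e (0 : R) = line_point R f x.
      by rewrite /line_arc h1 !mul0r addr0 oppr0.
    have a1 : line_arc f e (1 : R) = line_point R f y.
      by rewrite /line_arc h1 h2 subrr mulr0 !mul0r oppr0 mul1r addrC subrK.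
    rewrite a0 a1 eS; apply/seteqP; split=> z.
      by case=> ->; [exists x|exists y]; rewrite //= !inE eqxx ?orbT.
    by case=> v /= + <-; rewrite !inE => /orP[]/eqP->; [left|right].
  - move=> e v eE [t /=]; rewrite in_itv /= => /andP[t0 t1] [_ /eqP].
    rewrite oppr_eq0 gt_eqF // mulr_gt0 ?exprn_gt0 ?subr_gt0 ?lohi //.
    by rewrite mulr_gt0 // subr_gt0.
  (* A common point has the same abscissa and depth on both parabolas. The intervals then overlap,
     so they are nested and distinct, against [ltr_mul_nested]. *)
  - move=> e e' eE eE' ne; apply/seteqP; split=> // z [].
    case=> t /=; rewrite in_itv /= => /andP[t0 t1] <- [t' /=].
    rewrite in_itv /= => /andP[t'0 t'1] E.
    have := height e t; have := height e' t'; rewrite E => -> /oppr_inj.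
    set X : R := (line_arc f e t).1 => H.
    have [lX Xh] : (edge_lo f e)%:R < X /\ X < (edge_hi f e)%:R.
      have d0 : 0 < (edge_hi f e)%:R - (edge_lo f e)%:R :> R by rewrite subr_gt0 lohi.
      rewrite /X /line_arc /= ltrDl mulr_gt0 //; split=> //.
      by rewrite -ltrBrDl gtr_pMl.
    have XE : X = (line_arc f e' t').1 by rewrite E.
    have [lX' Xh'] : (edge_lo f e')%:R <= X /\ X <= (edge_hi f e')%:R.
      have d0 : 0 < (edge_hi f e')%:R - (edge_lo f e')%:R :> R by rewrite subr_gt0 lohi.
      rewrite XE /line_arc /= lerDl mulr_ge0 ?(ltW d0) //; split=> //.
      by rewrite -lerBrDl ger_pMl.
    have P0 : 0 < (X - (edge_lo f e)%:R) * ((edge_hi f e)%:R - X).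
      by rewrite mulr_gt0 // subr_gt0.
    have lX'' : (edge_lo f e')%:R < X.
      rewrite lt_neqAle lX' andbT; apply: contraTneq P0 => e0.
      by rewrite -H e0 subrr mul0r ltxx.
    have Xh'' : X < (edge_hi f e')%:R.
      rewrite lt_neqAle Xh' andbT; apply: contraTneq P0 => e0.
      by rewrite -H -e0 subrr mulr0 ltxx.
    have [x [y [xy _ eS h1 h2]]] := edge_sorted fi eE.
    have [x' [y' [xy' _ eS' h1' h2']]] := edge_sorted fi eE'.
    rewrite h1 h2 h1' h2' in lX Xh lX'' Xh'' H.
    have a1 : (f x' < f y)%N by rewrite -(ltr_nat R) (lt_trans lX'').
    have a2 : (f x < f y')%N by rewrite -(ltr_nat R) (lt_trans lX).
    have diff : ~~ ((f x == f x') && (f y == f y')).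
      apply/negP => /andP[/eqP/fi xx /eqP/fi yy]; apply: ne.
      by rewrite eS eS' xx yy.
    have nest : ((f x <= f x')%N && (f y' <= f y)%N) || ((f x' <= f x)%N && (f y <= f y')%N).
      have := nc x y x' y' xy xy'; have := nc x' y' x y xy' xy.
      by clear -a1 a2; case: (ltngtP (f x) (f x')) => //=;
        case: (ltngtP (f y) (f y')) => //=; lia.
    case/orP: nest => /andP[n1 n2].
      have : (X - (f x')%:R) * ((f y')%:R - X) < (X - (f x)%:R) * ((f y)%:R - X).
        apply: ltr_mul_nested; rewrite ?lX'' ?ler_nat // !ltr_nat.
        by clear -n1 n2 diff; lia.
      by rewrite H ltxx.
    have : (X - (f x)%:R) * ((f y)%:R - X) < (X - (f x')%:R) * ((f y')%:R - X).
      apply: ltr_mul_nested; rewrite ?lX ?ler_nat // !ltr_nat.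
      by clear -n1 n2 diff; lia.
    by rewrite H ltxx.
set D := drawing_set _ _; set F := connected_component (~` D) (0, 1).
have HD : [set z : R * R | 0 < z.2] `<=` ~` D.
  move=> z /= z0; rewrite /D /drawing_set => -[[v _ vz]|[e eE [t /= + tz]]].
    by move: z0; rewrite -vz /= ltxx.
  rewrite in_itv /= => /andP[t0 t1]; move: z0; rewrite -tz /= oppr_gt0 ltNge.
  by rewrite mulr_ge0 ?sqr_ge0 // mulr_ge0 // subr_ge0.
have HF : [set z : R * R | 0 < z.2] `<=` F.
  apply: connected_component_max => //=; exact: upper_half_plane_connected.
split=> //; exists F.
  split; first by exists (0, 1) => //; apply: HD => /=.
  (* The point [(0, |M| + 1)] of the half-plane has norm greater than [M]. *)
  move=> bF; have [M HM] := @filter_ex _ (pinfty_nbhs R) _ _ bF.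
  have : `|(0, `|M| + 1) : R * R| <= M.
    by apply: HM; apply: HF => /=; rewrite ltr_wpDl.
  rewrite prod_normE /= normr0 ge_max => /andP[_].
  rewrite ger0_norm ?addr_ge0 //; have := ler_norm M; lra.
move=> v; split.
  move=> B /nbhs_ballP[r r0 rB]; exists ((f v)%:R, r / 2); split.
    by apply: HF => /=; rewrite divr_gt0.
  apply/rB/nearbyE; rewrite /nearby /= subrr normr0 sub0r normrN r0 /=.
  by rewrite gtr0_norm ?divr_gt0 // ltr_pdivrMr // ltr_pMr // ltr1n.
move/interior_subset/connected_component_sub; apply; left.
by exists v.
Qed.

Lemma diamond_outerplanar (R : realType) : outerplanar R diamond.
Proof.
apply: (@noncrossing_outerplanar R diamond (@nat_of_ord 4));
  first exact: val_inj.
move=> [x x4] [y y4] [z z4] [w w4]; rewrite /= /diamond_adj -!val_eqE /=.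
by move: x y z w x4 y4 z4 w4; do 4![case=> [|[|[|[|]]]] //].
Qed.

End PlaneDrawings.

Theorem theorem13 (R : realType) :
  (forall G : sgraph,
     k_connected 2 G -> outerplanar R G -> max_degree G = 3 ->
     chi_vi G 2 <= 6) /\
  (exists G : sgraph,
     [/\ k_connected 2 G, outerplanar R G, max_degree G = 3 &
         chi_vi G 2 = 6]).
Proof.
have upper (G : sgraph) : k_connected 2 G -> outerplanar R G ->
    max_degree G = 3 -> chi_vi G 2 <= 6.
  move=> kc /outerplanar_theta_free tf md; have [_] := @chi_viP G 2 isT.
  by apply; exact: theta_free_colorable.
split=> //; exists diamond.
have kc := diamond_2connected; have op := diamond_outerplanar R.
have md := diamond_max_degree; split=> //.
apply/eqP; rewrite eqn_leq upper //=.
by have [/diamond_colors] := @chi_viP diamond 2 isT.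
Qed.
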